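(* Let $X\in\mathcal{M}_g$ be a closed hyperbolic surface of genus $g$. There exists a constant $C_X>0$ (depending only on $X$) such that for all $\varepsilon$ with $0<\varepsilon\leq\frac12$ there exists a closed geodesic $\gamma_\varepsilon$ on $X$ that is $\varepsilon$-dense on $X$ and such that $$\ell(\gamma_\varepsilon)\leq C_X\,\frac1\varepsilon\,\log\left(\frac1\varepsilon\right).$$
   Context: $\mathcal{M}_g$ is the moduli space of closed orientable hyperbolic surfaces of genus $g\geq 2$. $\ell(\gamma)$ denotes the length of $\gamma$. Closed geodesics are not required to be simple. A closed geodesic $\gamma$ on $X$ is $\varepsilon$-dense on $X$ if $d_X(x,\gamma)\leq\varepsilon$ for all $x\in X$, where $d_X$ is the hyperbolic distance on $X$. *)

(* Defs.v *)
From HB Require Import structures.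
From mathcomp Require Import all_boot all_order all_algebra.
From mathcomp Require Import complex.
From mathcomp Require Import all_classical all_reals all_analysis.
Import Order.TTheory GRing.Theory Num.Theory.
Import numFieldNormedType.Exports.

Set Implicit Arguments.
Unset Strict Implicit.
Unset Printing Implicit Defensive.

Local Open Scope classical_set_scope.
Local Open Scope ring_scope.

Definition upper_half_plane (R : realType) : set R[i] :=
  [set z | 0 < complex.Im z].

(* Inverse of cosh : [0, +oo[ -> [1, +oo[. *)
Definition arcosh (R : realType) (u : R) : R := ln (u + Num.sqrt (u ^+ 2 - 1)).

(* The distance of the Riemannian metric (dx^2 + dy^2) / y^2, in closed form.
   It is only meaningful on the upper half-plane. *)
Definition hdist (R : realType) (z w : R[i]) : R :=
  arcosh (1 + ((complex.Re z - complex.Re w) ^+ 2 +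
               (complex.Im z - complex.Im w) ^+ 2)
              / (2 * complex.Im z * complex.Im w)).

Definition mobius (R : realType) (A : 'M[R]_2) (z : R[i]) : R[i] :=
  ((A 0 0)%:C%C * z + (A 0 1)%:C%C) / ((A 1 0)%:C%C * z + (A 1 1)%:C%C).

(* A discrete subgroup of SL_2(R) whose image in PSL_2(R) acts freely on the
   upper half-plane, i.e. is torsion-free.  PSL_2(R) is the full group of
   orientation-preserving isometries, so the quotient is oriented. *)
Record free_fuchsian (R : realType) (G : set 'M[R]_2) : Prop := FreeFuchsian {
  fuchsian_det : forall A, G A -> \det A = 1;
  fuchsian_1 : G 1%:M;
  fuchsian_mul : forall A B, G A -> G B -> G (A *m B);
  fuchsian_inv : forall A, G A -> G (invmx A);
  fuchsian_discrete : forall A, G A -> isolated G A;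
  fuchsian_free : forall A z, G A -> @upper_half_plane R z ->
    mobius A z = z -> A = 1%:M \/ A = - 1%:M }.

(* p is, on the upper half-plane H, the projection of H onto the quotient G\H
   endowed with its quotient metric; its values outside H are irrelevant. *)
Record quotient_projection (R : realType) (X : metricType R)
    (G : set 'M[R]_2) (p : R[i] -> X) : Prop := QuotientProjection {
  proj_surj : p @` @upper_half_plane R = [set: X];
  proj_fiber : forall z w, upper_half_plane z -> upper_half_plane w ->
    (p z = p w <-> exists2 A, G A & w = mobius A z);
  proj_dist : forall z w, upper_half_plane z -> upper_half_plane w ->
    mdist (p z) (p w) = inf [set hdist z (mobius A w) | A in G] }.

Definition closed_hyperbolic_surface (R : realType) (X : metricType R) : Prop :=
  compact [set: X] /\
  exists (G : set 'M[R]_2) (p : R[i] -> X),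
    free_fuchsian G /\ quotient_projection G p.

(* n pairwise disjoint simple closed curves, each parametrized by R/Z, whose
   union does not separate X. *)
Definition nonseparating_curves (R : realType) (X : metricType R) (n : nat)
    (c : 'I_n -> R -> X) : Prop :=
  [/\ forall i, continuous (c i),
      forall i t, c i (t + 1) = c i t,
      forall i j s t, c i s = c j t -> i = j /\ exists k : int, s = t + k%:~R
    & connected (~` \bigcup_(i in [set: 'I_n]) range (c i))].

Definition has_genus (R : realType) (X : metricType R) (g : nat) : Prop :=
  (exists c : 'I_g -> R -> X, nonseparating_curves c) /\
  (forall (n : nat) (c : 'I_n -> R -> X),
     nonseparating_curves c -> (n <= g)%N).

(* c is a closed geodesic of length L, parametrized by arc length: on a
   hyperbolic surface the unit-speed geodesics are exactly the locally isometric
   maps from R.  No injectivity on [0, L[ is required: closed geodesics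
   need not be simple. *)
Definition closed_geodesic (R : realType) (X : metricType R) (c : R -> X)
    (L : R) : Prop :=
  [/\ 0 < L,
      forall t, c (t + L) = c t
    & forall t, exists2 d : R, 0 < d & forall s u,
        `|s - t| < d -> `|u - t| < d -> mdist (c s) (c u) = `|s - u|].

Definition dist_to (R : realType) (X : metricType R) (x : X) (S : set X) : R :=
  inf [set mdist x y | y in S].

Definition eps_dense (R : realType) (X : metricType R) (e : R) (S : set X) :
    Prop :=
  forall x : X, dist_to x S <= e.

(* Main.v *)
(* Write X = G\H with G discrete and cocompact in SL_2(R); every point of X
   lifts to a fixed box |x| <= M, 1/M <= y <= M of H.  The vertical geodesics
   over a grid of step e in [-M, M] come e-close to all of that box, so it
   suffices to find a closed geodesic having, for each grid point x_k, a lift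
   with one endpoint e-close to x_k and the other one e-close to infinity.
   For each k there is h_k in G with ||h_k|| = O(1/e) that maps the complement
   of the e-neighbourhood of x_k into the e-neighbourhood of infinity.  Playing
   ping-pong, the product h_1 ... h_N is hyperbolic and its cyclic conjugates
   have the required endpoints; its translation length is at most
   2 log ||h_1 ... h_N|| = O((1/e) log (1/e)), since N = O(1/e). *)

Require Import Defs.
From HB Require Import structures.
From mathcomp Require Import all_boot all_order all_algebra.
From mathcomp Require Import complex.
From mathcomp Require Import all_classical all_reals all_analysis.
From mathcomp Require Import ring lra.
Import Order.TTheory GRing.Theory Num.Theory.
Import numFieldNormedType.Exports.
Local Open Scope classical_set_scope.
Local Open Scope ring_scope.
Set Implicit Arguments.
Unset Strict Implicit.
Unset Printing Implicit Defensive.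

(** * Matrices of size 2 and the upper half-plane *)

(** The obstacle is a norm bound on [h_k] that is uniform in [x_k]. Cocompactness gives elements of
    G near any two frames, but the map they define may send the wrong direction to the place to be
    avoided, so an element of a bounded part of G is inserted as a correction. It exists because a
    pair of directions that no element of G separates would yield a direction fixed by all of G, and
    G would be triangular up to conjugation; compactness of the space of pairs of directions makes
    the bounds uniform. Closeness to the vertical geodesics is a second-order matter: errors of size
    e at the endpoints change the cosh of the distance by O(e^2), hence the distance by O(e). This
    is why the grid step can be proportional to the target density. Torsion-freeness enters when the
    axis is projected: it bounds from below the displacement of each point of the axis, which makes
    the projection locally isometric. *)

Definition mx2 (R : realType) (a b c d : R) : 'M[R]_2 :=
  \matrix_(i, j) if i == 0 then (if j == 0 then a else b)
                 else (if j == 0 then c else d).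

Lemma mx2E (R : realType) (a b c d : R) :
  (mx2 a b c d 0 0 = a) * (mx2 a b c d 0 1 = b) *
  (mx2 a b c d 1 0 = c) * (mx2 a b c d 1 1 = d).
Proof. by rewrite !mxE. Qed.

Lemma ord2P (P : 'I_2 -> Prop) : P 0 -> P 1 -> forall i, P i.
Proof.
move=> P0 P1 [[|[|//]] i]; first by rewrite (_ : Ordinal i = 0) //; exact/val_inj.
by rewrite (_ : Ordinal i = 1) //; exact/val_inj.
Qed.

Lemma mulmx2E (R : realType) (A B : 'M[R]_2) i j :
  (A *m B) i j = A i 0 * B 0 j + A i 1 * B 1 j.
Proof.
have e1 : lift ord0 (ord0 : 'I_1) = 1 :> 'I_2 by apply/val_inj.
by rewrite mxE big_ord_recl big_ord1 e1.
Qed.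

Lemma det2E (R : realType) (A : 'M[R]_2) :
  \det A = A 0 0 * A 1 1 - A 0 1 * A 1 0.
Proof.
rewrite (expand_det_row _ 0) !big_ord_recl big_ord0 addr0 /cofactor !det_mx11.
have e1 : lift ord0 (ord0 : 'I_1) = 1 :> 'I_2 by apply/val_inj.
have e2 : lift 1 (ord0 : 'I_1) = 0 :> 'I_2 by apply/val_inj.
rewrite !mxE !e1 !e2 /= expr0 expr1 mul1r; ring.
Qed.

Lemma mx2_eta (R : realType) (A : 'M[R]_2) :
  A = mx2 (A 0 0) (A 0 1) (A 1 0) (A 1 1).
Proof. by apply/matrixP; apply: ord2P; apply: ord2P; rewrite mx2E. Qed.

Lemma mulmx2 (R : realType) (a b c d a' b' c' d' : R) :
  mx2 a b c d *m mx2 a' b' c' d' =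
  mx2 (a * a' + b * c') (a * b' + b * d') (c * a' + d * c') (c * b' + d * d').
Proof. by rewrite [LHS]mx2_eta !mulmx2E !mx2E. Qed.

Lemma det_mx2 (R : realType) (a b c d : R) : \det (mx2 a b c d) = a * d - b * c.
Proof. by rewrite det2E !mx2E. Qed.

Lemma mx2_1 (R : realType) : 1%:M = mx2 1 0 0 1 :> 'M[R]_2.
Proof. by rewrite [LHS]mx2_eta !mxE. Qed.

Lemma mx2N (R : realType) (a b c d : R) :
  - mx2 a b c d = mx2 (- a) (- b) (- c) (- d).
Proof. by rewrite [LHS]mx2_eta !mxE. Qed.

Lemma unitmx_det1 (R : realType) (A : 'M[R]_2) : \det A = 1 -> A \in unitmx.
Proof. by move=> A1; rewrite unitmxE A1 unitr1. Qed.

Lemma det_mul1 (R : realType) (A B : 'M[R]_2) :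
  \det A = 1 -> \det B = 1 -> \det (A *m B) = 1.
Proof. by move=> A1 B1; rewrite det_mulmx A1 B1 mulr1. Qed.

Lemma det_inv1 (R : realType) (A : 'M[R]_2) : \det A = 1 -> \det (invmx A) = 1.
Proof. by move=> A1; rewrite det_inv A1 invr1. Qed.

Lemma invmx2 (R : realType) (A : 'M[R]_2) : \det A = 1 ->
  invmx A = mx2 (A 1 1) (- A 0 1) (- A 1 0) (A 0 0).
Proof.
move=> A1; have uA := unitmx_det1 A1.
suff e : A *m mx2 (A 1 1) (- A 0 1) (- A 1 0) (A 0 0) = 1%:M.
  by rewrite -[LHS]mulmx1 -e mulmxA mulVmx // mul1mx.
rewrite [X in X *m _]mx2_eta mulmx2 mx2_1; move: A1; rewrite det2E => <-.
by congr mx2; ring.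
Qed.

Lemma invmxM2 (R : realType) (A B : 'M[R]_2) : \det A = 1 -> \det B = 1 ->
  invmx (A *m B) = invmx B *m invmx A.
Proof.
move=> A1 B1; have uA := unitmx_det1 A1; have uB := unitmx_det1 B1.
have uAB := unitmx_det1 (det_mul1 A1 B1).
rewrite -[RHS]mulmx1 -(mulmxV uAB) mulmxA -(mulmxA (invmx B)) (mulmxA (invmx A)).
by rewrite mulVmx // mul1mx mulVmx // mul1mx.
Qed.

(** Squared Frobenius norm. On SL_2 it is invariant under inversion, and [nrm2 A / 2] is the cosh of
    the distance from [i] to its image by [A]. *)
Definition nrm2 (R : realType) (A : 'M[R]_2) : R :=
  A 0 0 ^+ 2 + A 0 1 ^+ 2 + A 1 0 ^+ 2 + A 1 1 ^+ 2.

Lemma nrm2_mx2 (R : realType) (a b c d : R) :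
  nrm2 (mx2 a b c d) = a ^+ 2 + b ^+ 2 + c ^+ 2 + d ^+ 2.
Proof. by rewrite /nrm2 !mx2E. Qed.

Lemma nrm2_ge0 (R : realType) (A : 'M[R]_2) : 0 <= nrm2 A.
Proof. by rewrite /nrm2 !addr_ge0 ?sqr_ge0. Qed.

Lemma sqr_le_nrm2 (R : realType) (A : 'M[R]_2) i j : A i j ^+ 2 <= nrm2 A.
Proof.
have h k l : 0 <= A k l ^+ 2 by exact: sqr_ge0.
have := h 0 0; have := h 0 1; have := h 1 0; have := h 1 1.
by rewrite /nrm2; move: i j; apply: ord2P; apply: ord2P; lra.
Qed.

Lemma cauchy_schwarz2 (R : realType) (a b x y : R) :
  (a * x + b * y) ^+ 2 <= (a ^+ 2 + b ^+ 2) * (x ^+ 2 + y ^+ 2).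
Proof.
rewrite -subr_ge0 [X in 0 <= X](_ : _ = (a * y - b * x) ^+ 2) ?sqr_ge0 //; ring.
Qed.

Lemma nrm2M (R : realType) (A B : 'M[R]_2) : nrm2 (A *m B) <= nrm2 A * nrm2 B.
Proof.
rewrite /nrm2 !mulmx2E.
have := cauchy_schwarz2 (A 0 0) (A 0 1) (B 0 0) (B 1 0).
have := cauchy_schwarz2 (A 0 0) (A 0 1) (B 0 1) (B 1 1).
have := cauchy_schwarz2 (A 1 0) (A 1 1) (B 0 0) (B 1 0).
have := cauchy_schwarz2 (A 1 0) (A 1 1) (B 0 1) (B 1 1).
lra.
Qed.

Lemma nrm2V (R : realType) (A : 'M[R]_2) : \det A = 1 ->
  nrm2 (invmx A) = nrm2 A.
Proof. by move=> A1; rewrite invmx2 // nrm2_mx2 /nrm2; ring. Qed.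

Lemma nrm2_det1 (R : realType) (A : 'M[R]_2) : \det A = 1 ->
  nrm2 A = 2 + (A 0 0 - A 1 1) ^+ 2 + (A 0 1 + A 1 0) ^+ 2.
Proof.
rewrite det2E => A1; rewrite /nrm2.
suff: 2 = 2 * (A 0 0 * A 1 1 - A 0 1 * A 1 0) by move=> {1}->; ring.
by rewrite A1 mulr1.
Qed.

Lemma nrm2_ge2 (R : realType) (A : 'M[R]_2) : \det A = 1 -> 2 <= nrm2 A.
Proof.
by move=> A1; rewrite nrm2_det1 // -addrA lerDl addr_ge0 ?sqr_ge0.
Qed.

(* Since SL_2(R) acts transitively on H, points are written as images of i;
   every distance then becomes a Frobenius norm. *)
Definition upt (R : realType) (A : 'M[R]_2) : R[i] := mobius A ('i)%C.

Lemma mobiusE (R : realType) (A : 'M[R]_2) (x y : R) : 0 < y -> \det A = 1 ->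
  let q := (A 1 0 * x + A 1 1) ^+ 2 + (A 1 0 * y) ^+ 2 in
  0 < q /\ mobius A (Complex x y) =
  Complex (((A 0 0 * x + A 0 1) * (A 1 0 * x + A 1 1) + A 0 0 * A 1 0 * y ^+ 2) / q)
          (y / q).
Proof.
move=> y0; rewrite det2E => A1 q.
have q0 : 0 < q.
  rewrite lt_neqAle addr_ge0 ?sqr_ge0 // andbT eq_sym paddr_eq0 ?sqr_ge0 //.
  rewrite !expf_eq0 /= mulf_eq0 (gt_eqF y0) orbF; apply/negP => /andP[+ /eqP c0].
  rewrite c0 mul0r add0r => /eqP d0.
  by move: A1; rewrite c0 d0 !mulr0 subr0 => /eqP; rewrite eq_sym oner_eq0.
split=> //; rewrite /mobius /=.
have dE : (A 1 0)%:C%C * Complex x y + (A 1 1)%:C%C =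
    Complex (A 1 0 * x + A 1 1) (A 1 0 * y).
  by apply/eqP; rewrite eq_complex /=; apply/andP; split; apply/eqP; ring.
have nE : (A 0 0)%:C%C * Complex x y + (A 0 1)%:C%C =
    Complex (A 0 0 * x + A 0 1) (A 0 0 * y).
  by apply/eqP; rewrite eq_complex /=; apply/andP; split; apply/eqP; ring.
rewrite dE nE; apply: (canLR (mulfK _)).
  apply/eqP => /(congr1 (fun z => complex.Re z ^+ 2 + complex.Im z ^+ 2)) /=.
  by rewrite expr0n addr0 => /eqP; rewrite -/q gt_eqF.
have {q0} : q != 0 by rewrite gt_eqF.
rewrite /q => {nE dE q} q0.
rewrite [X in _ = Complex _ X * _](_ : _ =
  y * (A 0 0 * A 1 1 - A 0 1 * A 1 0) / ((A 1 0 * x + A 1 1) ^+ 2 + (A 1 0 * y) ^+ 2));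
  last by rewrite A1 mulr1.
by apply/eqP; rewrite eq_complex /=; apply/andP; split; apply/eqP; field.
Qed.

Lemma uptE (R : realType) (A : 'M[R]_2) : \det A = 1 ->
  let q := A 1 0 ^+ 2 + A 1 1 ^+ 2 in
  0 < q /\ upt A = Complex ((A 0 0 * A 1 0 + A 0 1 * A 1 1) / q) (1 / q).
Proof.
move=> A1 q; have [] := mobiusE 0 ltr01 A1; rewrite -/(upt A) => + ->.
rewrite !mulr0 !add0r !mulr1 expr1n mulr1 [A 1 1 ^+ 2 + _]addrC -/q => q0.
by split=> //; congr (Complex (_ / _) _); ring.
Qed.

Lemma upt_im_gt0 (R : realType) (A : 'M[R]_2) : \det A = 1 ->
  upper_half_plane (upt A).
Proof.
by move=> /uptE[q0 ->]; rewrite /upper_half_plane /= divr_gt0.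
Qed.

Lemma mobius_den_neq0 (R : realType) (A : 'M[R]_2) z : \det A = 1 ->
  upper_half_plane z -> (A 1 0)%:C%C * z + (A 1 1)%:C%C != 0.
Proof.
case: z => x y A1; rewrite /upper_half_plane /= => y0.
have [q0 _] := mobiusE x y0 A1.
rewrite (_ : _ + _ = Complex (A 1 0 * x + A 1 1) (A 1 0 * y)); last first.
  by apply/eqP; rewrite eq_complex /=; apply/andP; split; apply/eqP; ring.
apply/eqP => /(congr1 (fun z => complex.Re z ^+ 2 + complex.Im z ^+ 2)) /=.
by rewrite expr0n addr0 => /eqP; rewrite gt_eqF.
Qed.

Lemma mobius_upt (R : realType) (A B : 'M[R]_2) : \det A = 1 -> \det B = 1 ->
  mobius A (upt B) = upt (A *m B).
Proof.
move=> A1 B1; have iH : upper_half_plane ('i : R[i])%C by exact: ltr01.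
have := mobius_den_neq0 (det_mul1 A1 B1) iH.
have := mobius_den_neq0 A1 (upt_im_gt0 B1).
have := mobius_den_neq0 B1 iH.
rewrite /upt /mobius !mulmx2E !rmorphD !rmorphM /=.
move: ('i : R[i])%C => z p0 u0 v0; field.
by apply/andP; split; [exact: v0 | exact: p0].
Qed.

Lemma hdist_upt (R : realType) (A B : 'M[R]_2) : \det A = 1 -> \det B = 1 ->
  hdist (upt A) (upt B) = arcosh (nrm2 (invmx A *m B) / 2).
Proof.
move=> A1 B1; have [qA ->] := uptE A1; have [qB ->] := uptE B1.
rewrite /hdist /=; congr arcosh; rewrite invmx2 // [X in nrm2 (_ *m X)]mx2_eta.
rewrite mulmx2 nrm2_mx2.
move: A1 B1; rewrite !det2E => A1 B1.
(* The squared determinant gives Lagrange's identity |row 0|^2 |row 1|^2 = <row 0, row 1>^2 + 1, the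
   content of [pA] and [pB]. *)
have {}A1 := congr1 (fun x => x ^+ 2) A1; have {}B1 := congr1 (fun x => x ^+ 2) B1.
rewrite expr1n in A1 B1.
have pA : (A 0 0 * A 1 0 + A 0 1 * A 1 1) ^+ 2 + 1 =
    (A 0 0 ^+ 2 + A 0 1 ^+ 2) * (A 1 0 ^+ 2 + A 1 1 ^+ 2) by rewrite -A1; ring.
have pB : (B 0 0 * B 1 0 + B 0 1 * B 1 1) ^+ 2 + 1 =
    (B 0 0 ^+ 2 + B 0 1 ^+ 2) * (B 1 0 ^+ 2 + B 1 1 ^+ 2) by rewrite -B1; ring.
rewrite [in RHS](_ : _ + _ =
  (A 0 0 ^+ 2 + A 0 1 ^+ 2) * (B 1 0 ^+ 2 + B 1 1 ^+ 2) +
  (B 0 0 ^+ 2 + B 0 1 ^+ 2) * (A 1 0 ^+ 2 + A 1 1 ^+ 2) -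
  2 * (A 0 0 * A 1 0 + A 0 1 * A 1 1) * (B 0 0 * B 1 0 + B 0 1 * B 1 1));
  last by ring.
have aux (m n p p' q q' : R) : m ^+ 2 + 1 = p * q -> n ^+ 2 + 1 = p' * q' ->
    0 < q -> 0 < q' ->
    1 + ((m / q - n / q') ^+ 2 + (1 / q - 1 / q') ^+ 2) /
      (2 * (1 / q) * (1 / q')) = (p * q' + p' * q - 2 * m * n) / 2.
  move=> pq pq' /lt0r_neq0 q0 /lt0r_neq0 q0'.
  rewrite -(mulfK q0 p) -pq -(mulfK q0' p') -pq'; field.
  by apply/andP; split.
exact: aux pA pB qA qB.
Qed.

Definition aff (R : realType) (x r : R) : 'M[R]_2 := mx2 r (x / r) 0 r^-1.

Lemma aff_det (R : realType) (x r : R) : r != 0 -> \det (aff x r) = 1.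
Proof. by move=> r0; rewrite det_mx2 mulfV // mulr0 subr0. Qed.

Lemma upt_aff (R : realType) (x r : R) : r != 0 ->
  upt (aff x r) = Complex x (r ^+ 2).
Proof.
move=> r0; have [_ ->] := uptE (aff_det x r0); rewrite !mx2E.
by congr Complex; field; rewrite r0.
Qed.

Lemma upper_half_planeP (R : realType) (z : R[i]) : upper_half_plane z ->
  exists x r, r != 0 /\ z = upt (aff x r).
Proof.
case: z => x y; rewrite /upper_half_plane /= => y0; exists x, (Num.sqrt y).
have r0 : Num.sqrt y != 0 by rewrite gt_eqF // sqrtr_gt0.
by split=> //; rewrite upt_aff // sqr_sqrtr // ltW.
Qed.

Lemma mobiusN (R : realType) (A : 'M[R]_2) z : mobius (- A) z = mobius A z.
Proof.
rewrite /mobius !mxE !rmorphN /= !mulNr -!opprD.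
by rewrite invrN mulrNN.
Qed.

(** * The quotient metric *)

Section Arcosh.
Context {R : realType}.
Implicit Types u v t D s : R.

Lemma arcosh_arg_gt0 u : 1 <= u -> 0 < u + Num.sqrt (u ^+ 2 - 1).
Proof. by move=> u1; rewrite ltr_pwDl ?sqrtr_ge0 // (lt_le_trans ltr01). Qed.

Lemma arcosh_cosh t : arcosh ((expR t + expR (- t)) / 2) = `|t|.
Proof.
wlog t0 : t / 0 <= t => [hw|].
  have [/hw//|/ltW t0] := leP 0 t; rewrite -normrN -hw ?oppr_ge0 // opprK.
  by rewrite [expR t + _]addrC.
have E : expR (- t) = (expR t)^-1 by rewrite expRN.
have e1 : 1 <= expR t by rewrite -expR0 ler_expR.
have e0 := expR_gt0 t.
rewrite /arcosh (_ : _ - 1 = ((expR t - expR (- t)) / 2) ^+ 2); last first.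
  by rewrite E; field; rewrite gt_eqF.
rewrite sqrtr_sqr ger0_norm; last first.
  rewrite divr_ge0 // subr_ge0 ler_expR; lra.
rewrite (_ : _ + _ = expR t); last by field.
by rewrite expRK ger0_norm.
Qed.

Lemma le_arcosh u v : 1 <= u -> u <= v -> arcosh u <= arcosh v.
Proof.
move=> u1 uv; have v1 := le_trans u1 uv.
rewrite /arcosh ler_ln ?posrE ?arcosh_arg_gt0 // lerD // ler_wsqrtr // lerB //.
by rewrite lerXn2r // nnegrE (le_trans ler01).
Qed.

Lemma arcosh_ge0 u : 1 <= u -> 0 <= arcosh u.
Proof.
by move=> u1; rewrite ln_ge0 // (le_trans u1) // lerDl sqrtr_ge0.
Qed.

Lemma arcosh_lt_expR u t : 1 <= u -> arcosh u < t -> u < expR t.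
Proof.
move=> u1 ut; rewrite -[u]lnK ?posrE ?(lt_le_trans ltr01) // ltr_expR.
apply: le_lt_trans ut; rewrite ler_ln ?posrE ?arcosh_arg_gt0 //.
  by rewrite lerDl sqrtr_ge0.
exact: lt_le_trans ltr01 u1.
Qed.

(** From ln(1 + t) <= t with t = D + sqrt(2 D + D^2): here D <= s, and the root is at most 2 s
    because D <= 1. This turns an O(s^2) excess in cosh into an O(s) distance. *)
Lemma arcosh1D_le D s : 0 <= D -> D <= s ^+ 2 -> 0 <= s <= 1 ->
  arcosh (1 + D) <= 3 * s.
Proof.
move=> D0 Ds /andP[s0 s1]; rewrite /arcosh.
have S : Num.sqrt ((1 + D) ^+ 2 - 1) <= 2 * s.
  rewrite -[leRHS]ger0_norm ?mulr_ge0 // -sqrtr_sqr ler_wsqrtr //.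
  have : D <= 1 by rewrite (le_trans Ds) // expr_le1.
  by nra.
apply: (@le_trans _ _ (D + Num.sqrt ((1 + D) ^+ 2 - 1))).
  rewrite -addrA le_ln1Dx // (lt_le_trans (ltrN10 _)) // addr_ge0 ?sqrtr_ge0 //.
have : s ^+ 2 <= s by rewrite expr2 ler_piMl.
lra.
Qed.

End Arcosh.

(** Geometrically, the orbit of [i] is a net in the half-plane: [nrm2 (invmx B *m A)] is twice the
    cosh of the distance from [B i] to [A i]. Quantifying over frames [B] keeps the quotient space
    out of the later arguments. *)
Definition cocompact (R : realType) (G : set 'M[R]_2) (M : R) : Prop :=
  forall B, \det B = 1 -> exists2 A, G A & nrm2 (invmx B *m A) <= M.

Section Quotient.
Context {R : realType} {X : metricType R} {G : set 'M[R]_2} {p : R[i] -> X}.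
Hypotheses (GF : free_fuchsian G) (Gp : quotient_projection G p).

Lemma proj_upt A B : G A -> \det B = 1 -> p (upt (A *m B)) = p (upt B).
Proof.
move=> GA B1; have A1 := fuchsian_det GF GA; apply/esym.
by apply/(proj_fiber Gp (upt_im_gt0 B1) (upt_im_gt0 (det_mul1 A1 B1)));
  exists A => //; rewrite mobius_upt.
Qed.

Lemma mdist_proj_upt A B : \det A = 1 -> \det B = 1 ->
  mdist (p (upt A)) (p (upt B)) =
  inf [set arcosh (nrm2 (invmx A *m (g *m B)) / 2) | g in G].
Proof.
move=> A1 B1; rewrite (proj_dist Gp (upt_im_gt0 A1) (upt_im_gt0 B1)).
congr inf; apply: eq_imagel => g Gg; have g1 := fuchsian_det GF Gg.
by rewrite mobius_upt // hdist_upt // det_mul1.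
Qed.

Lemma nrm2_half_ge1 (A : 'M[R]_2) : \det A = 1 -> 1 <= nrm2 A / 2.
Proof. by move/nrm2_ge2 => A2; rewrite ler_pdivlMr // mul1r. Qed.

Lemma mdist_proj_upt_le A B g : \det A = 1 -> \det B = 1 -> G g ->
  mdist (p (upt A)) (p (upt B)) <= arcosh (nrm2 (invmx A *m (g *m B)) / 2).
Proof.
move=> A1 B1 Gg; rewrite mdist_proj_upt //; apply: ge_inf; last by exists g.
exists 0 => _ [h Gh <-]; rewrite arcosh_ge0 // nrm2_half_ge1 //.
by rewrite !det_mul1 ?det_inv1 // (fuchsian_det GF).
Qed.

Lemma mdist_proj_upt_lt A B t : \det A = 1 -> \det B = 1 ->
  mdist (p (upt A)) (p (upt B)) < t ->
  exists2 g, G g & nrm2 (invmx A *m (g *m B)) < 2 * expR t.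
Proof.
move=> A1 B1; rewrite mdist_proj_upt // => /inf_lt[].
  by exists (arcosh (nrm2 (invmx A *m (1%:M *m B)) / 2)), 1%:M => //; exact: fuchsian_1.
move=> _ [g Gg <-] lt; exists g => //.
have g1 := fuchsian_det GF Gg.
rewrite -ltr_pdivrMl // mulrC arcosh_lt_expR // nrm2_half_ge1 //.
by rewrite !det_mul1 ?det_inv1.
Qed.

Lemma proj_surj_upt x : exists2 A, \det A = 1 & p (upt A) = x.
Proof.
have : [set: X] x by [].
rewrite -(proj_surj Gp) => -[z /upper_half_planeP[a [r [r0 ->]]] <-].
by exists (aff a r) => //; exact: aff_det.
Qed.

(** Points near [p (upt B)] have a lift of norm bounded in terms of [B]; near-covering compactness,
    with the bound [n] as the parameter going to infinity, makes that bound uniform. *)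
Lemma proj_cocompact : compact [set: X] -> exists M, cocompact G M.
Proof.
move=> /compact_near_coveringP /(_ nat \oo
  (fun n x => exists A, [/\ \det A = 1, p (upt A) = x & nrm2 A <= n%:R]) _).
case=> [x _|].
  have [B B1 <-] := proj_surj_upt x.
  set c := nrm2 B * (2 * expR 1).
  exists ([set y | mdist (p (upt B)) y < 1], [set n | c <= n%:R]); first split=> /=.
  - by rewrite -[X in nbhs _ X]ballEmdist; exact: nbhsx_ballx.
  - exact: nbhs_infty_ger.
  move=> [y n] /= [+ cn]; have [C C1 <-] := proj_surj_upt y.
  move=> /(mdist_proj_upt_lt B1 C1)[g Gg /ltW gle].
  have g1 := fuchsian_det GF Gg.
  exists (g *m C); split; [exact: det_mul1|exact: proj_upt|].
  apply: le_trans cn; rewrite -[g *m C]mul1mx -(mulmxV (unitmx_det1 B1)) -mulmxA.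
  by apply: le_trans (nrm2M _ _) _; rewrite ler_wpM2l // nrm2_ge0.
move=> n _ /(_ n (leqnn n)) nP; exists (2 * expR 1 * n%:R) => B B1.
have [C [C1 pC Cn]] := nP (p (upt B)) I.
have /esym/(proj_fiber Gp (upt_im_gt0 C1) (upt_im_gt0 B1))[g Gg] := esym pC.
move=> gE; exists g => //; have g1 := fuchsian_det GF Gg.
(* [g *m C] and [B] send [i] to the same point, so the distance is [arcosh 1], that is 0 < 1, whence
   the crude constant. *)
have BgC : nrm2 (invmx B *m (g *m C)) <= 2 * expR 1.
  rewrite mulrC -ler_pdivrMr // ltW // arcosh_lt_expR //.
    by rewrite nrm2_half_ge1 // !det_mul1 ?det_inv1.
  rewrite -hdist_upt ?det_mul1 // -mobius_upt // -gE /hdist !subrr.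
  by rewrite !expr0n !addr0 mul0r addr0 /arcosh expr1n subrr sqrtr0 addr0 ln1.
have -> : invmx B *m g = invmx B *m (g *m C) *m invmx C.
  by rewrite -!mulmxA mulmxV ?unitmx_det1 // mulmx1.
by rewrite (le_trans (nrm2M _ _)) // nrm2V // ler_pM ?nrm2_ge0.
Qed.

End Quotient.

Lemma fuchsian_isolated1 (R : realType) (G : set 'M[R]_2) : free_fuchsian G ->
  exists2 d : R, 0 < d & forall A, G A -> nrm2 (A - 1%:M) < d -> A = 1%:M.
Proof.
move=> GF; have [_ [V]] := fuchsian_discrete GF (fuchsian_1 GF).
rewrite -nbhs_ballE => -[e /= e0 eV VG].
exists (e ^+ 2) => [|A GA Ae]; first by rewrite exprn_gt0.
have : [set 1%:M] A; last by [].
rewrite -VG; split=> //; apply: eV; split=> // i j.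
rewrite /ball /= -ltr_sqr ?nnegrE ?(ltW e0) ?normr_ge0 //.
rewrite real_normK ?num_real // -sqrrN opprB.
by apply: le_lt_trans Ae; have := sqr_le_nrm2 (A - 1%:M) i j; rewrite !mxE.
Qed.

(** * Discrete cocompact subgroups *)

Record sl2_lattice (R : realType) (G : set 'M[R]_2) : Prop := Sl2Lattice {
  lat_det : forall A, G A -> \det A = 1;
  lat_1 : G 1%:M;
  lat_mul : forall A B, G A -> G B -> G (A *m B);
  lat_inv : forall A, G A -> G (invmx A);
  lat_isolated1 : exists2 d : R,
    0 < d & forall A, G A -> nrm2 (A - 1%:M) < d -> A = 1%:M;
  lat_cocompact : exists M, cocompact G M }.

Lemma fuchsian_lattice (R : realType) (X : metricType R) (G : set 'M[R]_2)
    (p : R[i] -> X) : compact [set: X] ->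
  free_fuchsian G ->
  quotient_projection G p -> sl2_lattice G.
Proof.
move=> Xc GF Gp; split; [exact: fuchsian_det|exact: fuchsian_1|
  exact: fuchsian_mul|exact: fuchsian_inv|exact: fuchsian_isolated1|].
exact: proj_cocompact GF Gp Xc.
Qed.

Definition conj_set (R : realType) (B : 'M[R]_2) (G : set 'M[R]_2) :=
  [set invmx B *m A *m B | A in G].

Lemma lattice_conj (R : realType) (B : 'M[R]_2) (G : set 'M[R]_2) :
  \det B = 1 -> sl2_lattice G -> sl2_lattice (conj_set B G).
Proof.
move=> B1 [Gdet G1 GM GV [d d0 Gd] [M GcM]].
have uB := unitmx_det1 B1; have B0 : 0 < nrm2 B.
  exact: lt_le_trans (nrm2_ge2 B1).
split.
- by move=> _ [A /Gdet A1 <-]; rewrite !det_mul1 ?det_inv1.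
- by exists 1%:M => //; rewrite mulmx1 mulVmx.
- move=> _ _ [A GA <-] [A' GA' <-]; exists (A *m A'); first exact: GM.
  by rewrite !mulmxA -(mulmxA _ B) mulmxV // mulmx1.
- move=> _ [A GA <-]; exists (invmx A); first exact: GV.
  have A1 := Gdet _ GA.
  by rewrite !invmxM2 ?det_mul1 ?det_inv1 // invmxK mulmxA.
- exists (d / (nrm2 B * nrm2 B)) => [|_ [A GA <-]].
    by rewrite divr_gt0 // mulr_gt0.
  rewrite ltr_pdivlMr ?mulr_gt0 // => lt; rewrite (Gd A) ?mulmx1 ?mulVmx //.
  apply: le_lt_trans lt.
  have -> : A - 1%:M = B *m (invmx B *m A *m B - 1%:M) *m invmx B.
    rewrite mulmxBr mulmx1 mulmxBl mulmxV // !mulmxA mulmxV // mul1mx.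
    by rewrite -mulmxA mulmxV // mulmx1.
  apply: le_trans (nrm2M _ _) _; rewrite nrm2V // mulrA ler_wpM2r ?nrm2_ge0 //.
  by rewrite mulrC nrm2M.
- exists (M * nrm2 B) => C C1.
  have [A GA AM] := GcM _ (det_mul1 B1 C1).
  exists (invmx B *m A *m B); first by exists A.
  rewrite mulmxA (le_trans (nrm2M _ _)) // ler_wpM2r ?nrm2_ge0 //.
  by rewrite mulmxA -invmxM2.
Qed.

Lemma lattice_cocompact_gt0 (R : realType) (G : set 'M[R]_2) (M : R) :
  sl2_lattice G -> cocompact G M -> 2 <= M.
Proof.
move=> GL GM; have [A GA AM] := GM 1%:M (det1 _ _).
apply: le_trans AM; apply: nrm2_ge2.
by rewrite det_mul1 ?det_inv1 ?det1 // (lat_det GL).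
Qed.

(** Made for the final contradiction of [lattice_not_triangular]: k (q - s) is the corner entry of a
    triangular matrix with diagonal q, s that commutes with a fixed one, and w is that entry after a
    translation by -x. When q s = 1 the left side is x^2, so x cannot be arbitrary. *)
Lemma centralizer_bound (R : realType) (q s w k M : R) :
  q ^+ 2 + w ^+ 2 + s ^+ 2 <= M ->
  (q * (k * (q - s)) - q * w) ^+ 2 <= 8 * M ^+ 2 * k ^+ 2 + 2 * M ^+ 2.
Proof.
move=> le; have q2 := sqr_ge0 q; have s2 := sqr_ge0 s; have w2 := sqr_ge0 w.
have k2 := sqr_ge0 k.
apply: (@le_trans _ _
    (2 * (q ^+ 2 * (k ^+ 2 * (q - s) ^+ 2)) + 2 * (q ^+ 2 * w ^+ 2))).
  rewrite -subr_ge0 [X in 0 <= X](_ : _ =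
    (q * (k * (q - s)) + q * w) ^+ 2) ?sqr_ge0 //; ring.
have qs4 : (q - s) ^+ 2 <= 4 * M.
  have -> : (q - s) ^+ 2 = 2 * q ^+ 2 + 2 * s ^+ 2 - (q + s) ^+ 2 by ring.
  by have := sqr_ge0 (q + s); lra.
have kq : k ^+ 2 * (q - s) ^+ 2 <= k ^+ 2 * (4 * M) by rewrite ler_wpM2l.
have qM : q ^+ 2 <= M by clear -le s2 w2; lra.
have wM : w ^+ 2 <= M by clear -le s2 q2; lra.
have h1 : q ^+ 2 * (k ^+ 2 * (q - s) ^+ 2) <= M * (k ^+ 2 * (4 * M)).
  by apply: ler_pM => //; rewrite mulr_ge0 ?sqr_ge0.
have h2 : q ^+ 2 * w ^+ 2 <= M * M by exact: ler_pM.
clear -h1 h2; move: (_ * (_ * _)) (q ^+ 2 * w ^+ 2) h1 h2 => y z h1 h2.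
by apply: le_trans (lerD (ler_wpM2l _ h1) (ler_wpM2l _ h2)) _ => //;
  rewrite le_eqVlt; apply/orP; left; apply/eqP; ring.
Qed.

(* In a triangular G, commutators are unipotent and conjugation by a diagonal
   element contracts them to 1, so by discreteness G is commutative; but then it
   cannot be cocompact. *)
Lemma lattice_not_triangular (R : realType) (G : set 'M[R]_2) :
  sl2_lattice G -> ~ (forall A, G A -> A 1 0 = 0).
Proof.
move=> GL tri; have [M GM] := lat_cocompact GL.
have M2 := lattice_cocompact_gt0 GL GM; have [d d0 Gd] := lat_isolated1 GL.
have Gtri A : G A -> A = mx2 (A 0 0) (A 0 1) 0 (A 1 1).
  by move=> GA; rewrite [LHS]mx2_eta tri.
have Gdet A : G A -> A 0 0 * A 1 1 = 1.
  by move=> GA; have := lat_det GL GA; rewrite det2E tri // mulr0 subr0.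
(* Near the frame diag(t, 1/t) with t^2 = 4 M, cocompactness forces [A 1 1 ^+ 2] to be at most
   1/4. *)
have [A GA Abig] : exists2 A, G A & 4 <= A 0 0 ^+ 2.
  pose t := Num.sqrt (4 * M); have t0 : 0 < t by rewrite sqrtr_gt0; lra.
  have t2 : t ^+ 2 = 4 * M by rewrite sqr_sqrtr //; lra.
  have [|A GA] := GM (mx2 t 0 0 t^-1).
    by rewrite det_mx2 mulfV ?gt_eqF // mulr0 subr0.
  rewrite invmx2 ?det_mx2 ?mulfV ?gt_eqF ?mulr0 ?subr0 // !mx2E.
  rewrite [A in _ *m A]Gtri // mulmx2 nrm2_mx2 => le; exists A => //.
  have {le} : (t * A 1 1) ^+ 2 <= M.
    apply: le_trans le; rewrite oppr0 !mul0r !add0r lerDr.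
    by rewrite !addr_ge0 ?sqr_ge0.
  rewrite exprMn t2 => le.
  have : 4 * A 1 1 ^+ 2 <= 1 by rewrite -(@ler_pM2l _ M) ?mulr1 //; lra.
  have := congr1 (fun x => x ^+ 2) (Gdet _ GA); rewrite expr1n exprMn.
  have := sqr_ge0 (A 0 0); nra.
have a0 : A 0 0 != 0 by apply: contraTneq Abig => ->; rewrite expr0n /= -ltNge.
have a11 : A 1 1 = (A 0 0)^-1 by rewrite -[RHS]mulr1 -(Gdet _ GA) mulrA mulVf ?mul1r.
set a : R := A 0 0 in Abig a0 a11; set b : R := A 0 1.
have AE : A = mx2 a b 0 a^-1 by rewrite [LHS]Gtri // a11.
have iAE : invmx A = mx2 a^-1 (- b) 0 a.
  by rewrite invmx2 ?(lat_det GL) // AE !mx2E oppr0.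
(* Each conjugation by [A] divides [tau] by [a ^+ 2], at least 4, so the conjugates tend to 1;
   discreteness makes one of them equal to 1. *)
have unip tau : G (mx2 1 tau 0 1) -> tau = 0.
  move=> Gt; have Gn n : G (mx2 1 (tau / (a ^+ 2) ^+ n) 0 1).
    elim: n => [|n IHn]; first by rewrite expr0 divr1.
    have := lat_mul GL (lat_mul GL (lat_inv GL GA) IHn) GA.
    rewrite iAE [X in _ *m X]AE !mulmx2 (exprSr _ n) invfM mulrA.
    move: (tau / _) => y; congr (G (mx2 _ _ _ _)); field;
      rewrite ?a0 ?expf_neq0 ?expf_neq0 //.
  pose n := (Num.Def.truncn (tau ^+ 2 / d)).+1.
  have nlt : tau ^+ 2 < d * 4 ^+ n.
    rewrite mulrC -ltr_pdivrMr //; apply: lt_trans (truncnS_gt _) _.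
    by rewrite -/n -natrX ltr_nat ltn_expl.
  have := Gd _ (Gn n); rewrite mx2_1 [- _]mx2N.
  set y := _ / _ ^+ _ => /(_ _)/(congr1 (fun B : matrix R 2 2 => B 0 1)).
  rewrite !mx2E => yP.
  have y0 : y = 0.
    apply: yP; rewrite /nrm2 !mxE /=.
    rewrite !subrr !subr0 !expr0n !addr0 add0r /y exprMn.
    have z4 : 4 ^+ n <= (a ^+ 2) ^+ n by rewrite lerXn2r ?nnegrE ?sqr_ge0.
    have z1 : 1 <= 4 ^+ n :> R by rewrite exprn_ege1 // ler1n.
    move: nlt z1 z4; move: (4 ^+ n) ((a ^+ 2) ^+ n) => w z nlt w1 wz.
    have z0 : 0 < z by lra.
    rewrite exprVn ltr_pdivrMr ?exprn_gt0 // (lt_le_trans nlt) // ler_pM2l //.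
    by rewrite expr2; nra.
  by move/eqP: y0; rewrite mulf_eq0 invr_eq0 !expf_eq0 (negPf a0) !andbF orbF => /eqP.
(* The commutator of [A] and [B] is unipotent, hence 1 by [unip]. So [B] is determined by its
   diagonal. *)
have comm B : G B -> B 0 1 * (a - a^-1) = b * (B 0 0 - B 1 1).
  move=> GB; have BE := Gtri _ GB; have Bd := Gdet _ GB.
  set q : R := B 0 0 in BE Bd *; set s : R := B 1 1 in BE Bd *.
  set r : R := B 0 1 in BE *.
  have iBE : invmx B = mx2 s (- r) 0 q.
    by rewrite invmx2 ?(lat_det GL) // BE !mx2E oppr0.
  have := lat_mul GL (lat_mul GL GA GB) (lat_mul GL (lat_inv GL GA) (lat_inv GL GB)).
  have q0 : q != 0 by apply: contra_eq_neq Bd => ->; rewrite mul0r eq_sym oner_eq0.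
  have sE : s = q^-1 by rewrite -[LHS]mul1r -(mulVf q0) -mulrA Bd mulr1.
  rewrite iAE iBE AE BE !mulmx2 => Gc.
  have : q * a * (r * (a - a^-1) - b * (q - s)) = 0.
    apply: unip; move: Gc; congr (G (mx2 _ _ _ _)); rewrite sE; field;
      by rewrite ?a0 ?q0.
  by move/eqP; rewrite !mulf_eq0 (negPf a0) (negPf q0) /= subr_eq0 => /eqP.
have kP : a - a^-1 != 0.
  apply/eqP => /(congr1 (fun x => x * a)); rewrite mulrBl mulVf // mul0r -expr2.
  by move=> /eqP; rewrite subr_eq0 => /eqP e; move: Abig; rewrite e; lra.
(* [x] exceeds by 1 the bound that [centralizer_bound] gives for [x ^+ 2], while x <= x^2. *)
pose k := b / (a - a^-1); pose x := 1 + 8 * M ^+ 2 * k ^+ 2 + 2 * M ^+ 2.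
have [|B GB] := GM (mx2 1 x 0 1); first by rewrite det_mx2 mulr0 subr0 mulr1.
rewrite invmx2 ?det_mx2 ?mulr0 ?subr0 ?mulr1 // !mx2E.
rewrite [B in _ *m B]Gtri // mulmx2 nrm2_mx2.
have qE : B 0 1 = k * (B 0 0 - B 1 1).
  by rewrite /k mulrAC -comm // mulfK.
have := Gdet _ GB; move: (B 0 0) (B 0 1) (B 1 1) qE => q r s -> qs le.
have xE : x = q * (k * (q - s)) - q * (k * (q - s) - x * s).
  by rewrite -[LHS]mulr1 -qs; ring.
set w := k * (q - s) - x * s in xE.
have {}le : q ^+ 2 + w ^+ 2 + s ^+ 2 <= M.
  apply: le_trans le; rewrite le_eqVlt; apply/orP; left; apply/eqP.
  by rewrite /w; ring.
have x2 := centralizer_bound k le; rewrite -xE in x2.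
have x1 : 1 <= x.
  rewrite /x -addrA lerDl; exact: (addr_ge0 (mulr_ge0 (mulr_ge0 (ler0n _ 8)
    (sqr_ge0 _)) (sqr_ge0 _)) (mulr_ge0 (ler0n _ 2) (sqr_ge0 _))).
have : x <= x ^+ 2 by rewrite expr2 ler_peMl //; lra.
by move=> /le_trans /(_ x2); rewrite /x -[leLHS]addrA gerDr ler10.
Qed.

(** * Transversality: moving one direction off another, uniformly *)

Definition bil (R : realType) (A : 'M[R]_2) (u0 u1 v0 v1 : R) : R :=
  u0 * (A 0 0 * v0 + A 0 1 * v1) + u1 * (A 1 0 * v0 + A 1 1 * v1).

(** The form vanishes when [f] sends v into the line orthogonal to u. If all of G does so, [f = 1]
    shows that v spans this line, so v is a common eigenvector; in a frame whose first column is v,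
    G is triangular. *)
Lemma lattice_irreducible (R : realType) (G : set 'M[R]_2) (u0 u1 v0 v1 : R) :
  sl2_lattice G -> u0 ^+ 2 + u1 ^+ 2 != 0 -> v0 ^+ 2 + v1 ^+ 2 != 0 ->
  exists2 f, G f & bil f u0 u1 v0 v1 != 0.
Proof.
set n := v0 ^+ 2 + _ => GL u n0; apply: contrapT => nex.
have {nex} bil0 f : G f -> bil f u0 u1 v0 v1 = 0.
  by move=> Gf; apply/eqP/negPn/negP => b0; apply: nex; exists f.
have uv : u0 * v0 + u1 * v1 = 0.
  by rewrite -[RHS](bil0 _ (lat_1 GL)) /bil mx2_1 !mx2E; ring.
pose m := u1 * v0 - u0 * v1.
have nu0 : n * u0 = - (v1 * m).
  by rewrite /n /m -[LHS]subr0 -(mulr0 v0) -uv; ring.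
have nu1 : n * u1 = v0 * m.
  by rewrite /n /m -[LHS]subr0 -(mulr0 v1) -uv; ring.
have m0 : m != 0.
  apply: contraNneq u => m0; move/eqP: nu0; move/eqP: nu1.
  rewrite m0 !mulr0 oppr0 !mulf_eq0 (negPf n0) /= => /eqP-> /eqP->.
  by rewrite expr0n addr0.
pose B := mx2 v0 (- v1 / n) v1 (v0 / n).
have B1 : \det B = 1 by rewrite det_mx2 /n; field.
apply: (lattice_not_triangular (lattice_conj B1 GL)) => _ [f Gf <-].
rewrite !mulmx2E invmx2 // !mx2E.
have : m * (v0 * (f 1 0 * v0 + f 1 1 * v1) - v1 * (f 0 0 * v0 + f 0 1 * v1)) = 0.
  transitivity (n * bil f u0 u1 v0 v1); last by rewrite bil0 // mulr0.
  by rewrite /bil [RHS]mulrDr 2!(mulrA n) nu0 nu1; ring.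
by move=> /eqP; rewrite mulf_eq0 (negPf m0) /= => /eqP <-; ring.
Qed.

Lemma bil_continuous (R : realType) (A : 'M[R]_2) :
  continuous (fun x : R * R => bil A 1 x.1 1 x.2 ^+ 2).
Proof.
move=> x; rewrite /bil.
under eq_fun do rewrite expr2.
have h : (fun y : R * R => 1 * (A 0 0 * 1 + A 0 1 * y.2) +
    y.1 * (A 1 0 * 1 + A 1 1 * y.2)) @ x -->
    1 * (A 0 0 * 1 + A 0 1 * x.2) + x.1 * (A 1 0 * 1 + A 1 1 * x.2).
  have cs k l : (fun y : R * R => A k 0 * 1 + A l 1 * y.2) @ x -->
      A k 0 * 1 + A l 1 * x.2.
    by apply: cvgD; [exact: cvg_cst|apply: cvgM; [exact: cvg_cst|exact: cvg_snd]].
  apply: cvgD; apply: cvgM => //; [exact: cvg_cst|exact: cvg_fst].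
exact: cvgM.
Qed.

(** At a given pair of slopes some [f] works, and by continuity the same [f] works nearby;
    compactness of the square gives one [n]. [S] is an arbitrary set because it will also be a
    product of G with the coordinate swap, whose determinant is -1. *)
Lemma bil_square_bound (R : realType) (S : set 'M[R]_2) :
  (forall s t, exists2 f, S f & bil f 1 s 1 t != 0) ->
  exists n : nat, forall s t, `|s| <= 1 -> `|t| <= 1 ->
    exists f, [/\ S f, nrm2 f <= n%:R & 1 <= n%:R * bil f 1 s 1 t ^+ 2].
Proof.
move=> S0; have K : compact (`[-1 : R, 1]%classic `*` `[-1 : R, 1]%classic).
  by apply: compact_setX; exact: segment_compact.
have /compact_near_coveringP/(_ nat \oo (fun n (x : R * R) =>
  exists f, [/\ S f, nrm2 f <= n%:R & 1 <= n%:R * bil f 1 x.1 1 x.2 ^+ 2]) _) := K.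
case=> [[s t] _|n _ /(_ n (leqnn n)) nP].
  have [f Sf f0] := S0 s t; set b := bil f 1 s 1 t ^+ 2.
  have b0 : 0 < b by rewrite lt_neqAle sqr_ge0 andbT eq_sym expf_neq0.
  exists ([set x : R * R | b / 2 < bil f 1 x.1 1 x.2 ^+ 2],
      [set n | nrm2 f <= n%:R] `&` [set n | 2 / b <= n%:R]); first split=> /=.
  - have /cvgr_gt := @bil_continuous R f (s, t); apply.
    by rewrite -/b; lra.
  - by apply: filterI; exact: nbhs_infty_ger.
  move=> [[x y] n] /= [bx [fn bn]]; exists f; split=> //.
  rewrite [leLHS](_ : _ = 2 / b * (b / 2)); last by field; rewrite gt_eqF.
  by apply: ler_pM bn (ltW bx); rewrite divr_ge0 // ltW.
exists n => s t s1 t1; apply: (nP (s, t)); split=> /=; rewrite in_itv /=.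
  by rewrite -ler_norml.
by rewrite -ler_norml.
Qed.

Lemma bil_cone_bound (R : realType) (S : set 'M[R]_2) :
  (forall u0 u1 v0 v1, u0 ^+ 2 + u1 ^+ 2 != 0 -> v0 ^+ 2 + v1 ^+ 2 != 0 ->
     exists2 f, S f & bil f u0 u1 v0 v1 != 0) ->
  exists n : nat, forall u0 u1 v0 v1, `|u1| <= `|u0| -> `|v1| <= `|v0| ->
    exists f, [/\ S f, nrm2 f <= n%:R &
      (u0 * v0) ^+ 2 <= n%:R * bil f u0 u1 v0 v1 ^+ 2].
Proof.
move=> S0; have [|n nP] := @bil_square_bound _ S.
  by move=> s t; apply: S0; rewrite gt_eqF // expr1n ltr_pwDl // sqr_ge0.
exists n => u0 u1 v0 v1 u v.
have q (x y : R) : `|y| <= `|x| -> exists s, `|s| <= 1 /\ y = x * s.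
  have [->|x0] := eqVneq x 0.
    by rewrite normr0 normr_le0 => /eqP->; exists 0; rewrite normr0 mulr0.
  move=> yx; exists (y / x); split; last by field.
  by rewrite normrM normfV ler_pdivrMr ?normr_gt0 // mul1r.
have [s [s1 ->]] := q _ _ u; have [t [t1 ->]] := q _ _ v.
have [f [Sf fn bf]] := nP s t s1 t1; exists f; split=> //.
have -> : bil f u0 (u0 * s) v0 (v0 * t) = (u0 * v0) * bil f 1 s 1 t.
  by rewrite /bil; ring.
by rewrite [in leRHS]exprMn mulrCA ler_peMr // sqr_ge0.
Qed.

(** The directions are covered by |u1| <= |u0| and its mirror image under the swap [J], so four cone
    bounds cover all pairs; the factor 4 comes from u0^2 + u1^2 <= 2 u0^2, used for both vectors. *)
Lemma lattice_transversal (R : realType) (G : set 'M[R]_2) : sl2_lattice G ->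
  exists n : nat, forall u0 u1 v0 v1, exists f, [/\ G f, nrm2 f <= n%:R &
    (u0 ^+ 2 + u1 ^+ 2) * (v0 ^+ 2 + v1 ^+ 2) <= n%:R * bil f u0 u1 v0 v1 ^+ 2].
Proof.
move=> GL; pose J := mx2 0 1 1 0 : 'M[R]_2.
have irr := @lattice_irreducible _ _ _ _ _ _ GL.
have JE (f : 'M[R]_2) : J *m f = mx2 (f 1 0) (f 1 1) (f 0 0) (f 0 1).
  by rewrite [f in LHS]mx2_eta mulmx2; congr mx2; ring.
have EJ (f : 'M[R]_2) : f *m J = mx2 (f 0 1) (f 0 0) (f 1 1) (f 1 0).
  by rewrite [f in LHS]mx2_eta mulmx2; congr mx2; ring.
have bJ f u0 u1 v0 v1 : bil (J *m f) u0 u1 v0 v1 = bil f u1 u0 v0 v1.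
  by rewrite JE /bil !mx2E addrC.
have Jb f u0 u1 v0 v1 : bil (f *m J) u0 u1 v0 v1 = bil f u0 u1 v1 v0.
  by rewrite EJ /bil !mx2E; ring.
have nJ f : nrm2 (J *m f) = nrm2 f by rewrite JE nrm2_mx2 /nrm2; ring.
have Jn f : nrm2 (f *m J) = nrm2 f by rewrite EJ nrm2_mx2 /nrm2; ring.
have [n1 h1] := @bil_cone_bound _ G irr.
have [|n2 h2] := @bil_cone_bound _ [set J *m f | f in G].
  move=> u0 u1 v0 v1 u v; have [|f Gf b] := irr u1 u0 v0 v1 _ v.
    by rewrite addrC.
  by exists (J *m f); [exists f|rewrite bJ].
have [|n3 h3] := @bil_cone_bound _ [set f *m J | f in G].
  move=> u0 u1 v0 v1 u v; have [|f Gf b] := irr u0 u1 v1 v0 u.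
    by rewrite addrC.
  by exists (f *m J); [exists f|rewrite Jb].
have [|n4 h4] := @bil_cone_bound _ [set J *m f *m J | f in G].
  move=> u0 u1 v0 v1 u v; have [||f Gf b] := irr u1 u0 v1 v0.
  - by rewrite addrC.
  - by rewrite addrC.
  by exists (J *m f *m J); [exists f|rewrite Jb bJ].
have big (n : nat) (u0 u1 v0 v1 b : R) : `|u1| <= `|u0| -> `|v1| <= `|v0| ->
    (u0 * v0) ^+ 2 <= n%:R * b ^+ 2 -> (n <= n1 + n2 + n3 + n4)%N ->
    (u0 ^+ 2 + u1 ^+ 2) * (v0 ^+ 2 + v1 ^+ 2) <=
      (4 * (n1 + n2 + n3 + n4))%N%:R * b ^+ 2.
  move=> u v le nn.
  apply: (@le_trans _ _ (4 * (u0 * v0) ^+ 2)).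
    have sq (x y : R) : `|y| <= `|x| -> x ^+ 2 + y ^+ 2 <= 2 * x ^+ 2.
      move=> yx; rewrite mulr2n mulrDl mul1r lerD2l.
      by rewrite -(real_normK (num_real y)) -(real_normK (num_real x)) lerXn2r ?nnegrE.
    rewrite exprMn (_ : 4 * _ = 2 * u0 ^+ 2 * (2 * v0 ^+ 2)); last by ring.
    by apply: ler_pM; rewrite ?addr_ge0 ?sqr_ge0 ?sq.
  rewrite natrM -mulrA ler_wpM2l // (le_trans le) // ler_wpM2r ?sqr_ge0 //.
  by rewrite ler_nat.
exists (4 * (n1 + n2 + n3 + n4))%N => u0 u1 v0 v1.
have nle (n : nat) (x : R) : x <= n%:R -> (n <= n1 + n2 + n3 + n4)%N ->
    x <= (4 * (n1 + n2 + n3 + n4))%N%:R.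
  by move=> xn nn; rewrite (le_trans xn) // ler_nat (leq_trans nn) // leq_pmull.
have L1 : (n1 <= n1 + n2 + n3 + n4)%N by rewrite -!addnA leq_addr.
have L2 : (n2 <= n1 + n2 + n3 + n4)%N by rewrite -!addnA addnCA leq_addr.
have L3 : (n3 <= n1 + n2 + n3 + n4)%N by rewrite addnAC leq_addl.
have L4 : (n4 <= n1 + n2 + n3 + n4)%N by rewrite leq_addl.
have [u|/ltW u] := leP `|u1| `|u0|; have [v|/ltW v] := leP `|v1| `|v0|.
- have [f [Gf fn fb]] := h1 _ _ _ _ u v; exists f.
  by split; [|exact: nle fn L1|exact: big fb L1].
- have [_ [[f Gf <-]]] := h3 _ _ _ _ u v; rewrite Jn Jb => fn fb; exists f.
  by split=> //; [exact: nle fn L3|rewrite [v0 ^+ 2 + _]addrC; exact: big fb L3].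
- have [_ [[f Gf <-]]] := h2 _ _ _ _ u v; rewrite nJ bJ => fn fb; exists f.
  by split=> //; [exact: nle fn L2|rewrite [u0 ^+ 2 + _]addrC; exact: big fb L2].
- have [_ [[f Gf <-]]] := h4 _ _ _ _ u v; rewrite Jn nJ Jb bJ => fn fb; exists f.
  split=> //; first exact: nle fn L4.
  by rewrite [v0 ^+ 2 + _]addrC [u0 ^+ 2 + _]addrC; exact: big fb L4.
Qed.

(** * Group elements mapping the outside of a cone into the cone at infinity *)

Lemma row_col_lower_bound (R : realType) (A : 'M[R]_2) (M : R) :
  \det A = 1 -> nrm2 A <= M ->
  1 <= M * (A 0 0 ^+ 2 + A 0 1 ^+ 2) /\ 1 <= M * (A 0 0 ^+ 2 + A 1 0 ^+ 2).
Proof.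
rewrite det2E /nrm2 => A1 AM.
have A2 : 1 = (A 0 0 * A 1 1 - A 0 1 * A 1 0) ^+ 2 by rewrite A1 expr1n.
(* The determinant 1 is the inner product of a row (or column) with the other one rotated, so
   neither is short when the other is bounded. *)
have := cauchy_schwarz2 (A 1 1) (- A 1 0) (A 0 0) (A 0 1).
have := cauchy_schwarz2 (A 1 1) (- A 0 1) (A 0 0) (A 1 0).
have -> : A 1 1 * A 0 0 + - A 0 1 * A 1 0 = 1 by rewrite -A1; ring.
have -> : A 1 1 * A 0 0 + - A 1 0 * A 0 1 = 1 by rewrite -A1; ring.
rewrite expr1n !sqrrN => le1 le2.
have s00 := sqr_ge0 (A 0 0); have s01 := sqr_ge0 (A 0 1).
have s10 := sqr_ge0 (A 1 0); have s11 := sqr_ge0 (A 1 1).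
split.
  apply: le_trans le2 _; rewrite ler_wpM2r ?addr_ge0 //; apply: le_trans AM.
  by rewrite addrC -!addrA ler_wpDl // ler_wpDl.
apply: le_trans le1 _; rewrite ler_wpM2r ?addr_ge0 //; apply: le_trans AM.
by rewrite addrC lerD2r -addrA addrCA lerDl addr_ge0.
Qed.

(** Entries of [W] are at most [T] and its first one is at least 1/T in absolute value, so a
    direction within slope [k] of infinity lands at distance at least [k] from 0. With k T^2 = 1/4
    this amounts to (1 + k)/4 <= 1 - 1/4. *)
Lemma cone_step (R : realType) (W : 'M[R]_2) (T k y0 y1 : R) :
  1 <= T -> nrm2 W <= T -> 1 <= T * W 0 0 ^+ 2 -> k * (4 * T ^+ 2) = 1 ->
  `|y1| <= k * `|y0| ->
  k * `|W 1 0 * y0 + W 1 1 * y1| <= `|W 0 0 * y0 + W 0 1 * y1|.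
Proof.
move=> T1 WT W00 kT yk.
have T0 : 0 < T by lra.
have k0 : 0 < k.
  have : 0 < k * (4 * T ^+ 2) by rewrite kT.
  by rewrite pmulr_lgt0 // mulr_gt0 // exprn_gt0.
have entry i j : `|W i j| <= T.
  rewrite -(ler_pXn2r (ltn0Sn 1)) ?nnegrE ?(ltW T0) // real_normK ?num_real //.
  apply: le_trans (sqr_le_nrm2 _ _ _) (le_trans WT _).
  by rewrite expr2 ler_peMr ?(ltW T0).
have big : 1 <= T * `|W 0 0|.
  have Tw : 0 <= T * `|W 0 0| by rewrite mulr_ge0 // ltW.
  suff : 1 <= (T * `|W 0 0|) ^+ 2 by rewrite expr_ge1.
  rewrite exprMn real_normK ?num_real //; apply: le_trans W00 _.
  by rewrite ler_wpM2r ?sqr_ge0 // expr2 ler_peMr ?(ltW T0).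
have w1 : `|W 1 0 * y0 + W 1 1 * y1| <= T * `|y0| + T * (k * `|y0|).
  by rewrite (le_trans (ler_normD _ _)) // !normrM lerD // ler_pM.
have w0 : `|W 0 0| * `|y0| - T * (k * `|y0|) <= `|W 0 0 * y0 + W 0 1 * y1|.
  have := ler_normB (W 0 0 * y0 + W 0 1 * y1) (W 0 1 * y1).
  rewrite addrK lerBlDr normrM => /le_trans; apply.
  by rewrite lerD2l normrM ler_pM.
apply: le_trans _ w0; apply: le_trans (ler_wpM2l (ltW k0) w1) _.
have -> : k * (T * `|y0| + T * (k * `|y0|)) = (k * T + k * T * k) * `|y0| by ring.
have -> : `|W 0 0| * `|y0| - T * (k * `|y0|) = (`|W 0 0| - k * T) * `|y0| by ring.
rewrite ler_wpM2r // -(ler_pM2l T0).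
apply: (@le_trans _ _ (1 - k * T ^+ 2)); last first.
  by rewrite mulrBr [T * (k * T)]mulrCA -expr2 lerD2r.
have kk : k <= 1.
  rewrite -[leRHS]kT ler_peMr ?(ltW k0) //.
  have : 1 <= T ^+ 2 by rewrite expr_ge1 ?(ltW T0).
  lra.
have kT2 : k * T ^+ 2 * k <= k * T ^+ 2.
  by rewrite ler_piMr // mulr_ge0 ?sqr_ge0 // ltW.
have -> : T * (k * T + k * T * k) = k * T ^+ 2 + k * T ^+ 2 * k by ring.
have : k * T ^+ 2 * 4 = 1 by rewrite -[RHS]kT; ring.
lra.
Qed.

(* [h = gQ f gP^-1], where gP and gQ in G lie near the frames at the bottom and
   at the top of the vertical geodesic over x, and f, from a bounded part of G,
   moves the direction gP^-1(infinity) away from gQ^-1(x). *)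
Lemma lattice_cone_map (R : realType) (G : set 'M[R]_2) (X0 : R) :
  sl2_lattice G -> exists C : R, 0 < C /\
  forall x e, `|x| <= X0 -> 0 < e -> e <= 1 -> exists h : 'M[R]_2,
    [/\ G h, nrm2 h <= C / e ^+ 2 &
      forall v0 v1, e * `|v1| <= `|v0 - x * v1| ->
        `|h 1 0 * v0 + h 1 1 * v1| <= e * `|h 0 0 * v0 + h 0 1 * v1|].
Proof.
move=> GL; have [M GM] := lat_cocompact GL.
have M2 := lattice_cocompact_gt0 GL GM; have M0 : 0 < M by lra.
have [n nP] := lattice_transversal GL.
pose T := M ^+ 2 * (n%:R + 1); pose k := (4 * T ^+ 2)^-1.
have n0 : 0 <= n%:R :> R by [].
have T1 : 1 <= T.
  by rewrite /T -[leLHS]mulr1 ler_pM // ?expr_ge1 ?(ltW M0) //; lra.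
have T0 : 0 < T by lra.
have k0 : 0 < k by rewrite invr_gt0 mulr_gt0 // exprn_gt0.
have kT : k * (4 * T ^+ 2) = 1 by rewrite mulVf // gt_eqF // mulr_gt0 // exprn_gt0.
exists (2 * T * (2 + X0 ^+ 2) / k ^+ 2); split.
  by rewrite divr_gt0 ?exprn_gt0 // !mulr_gt0 // ltr_pwDl // sqr_ge0.
(* The frame [P] sits at height k e over [x], and [Q] at height 1/(k e) over 0: [invmx P] maps the
   outside of the e-cone at [x] into the k-cone at infinity, and [Q] maps the outside of the k-cone
   at 0 into the e-cone at infinity. *)
move=> x e xX e0 e1; pose r := Num.sqrt (k * e).
have r0 : 0 < r by rewrite sqrtr_gt0 mulr_gt0.
have rN0 : r != 0 by rewrite gt_eqF.
have r2 : r ^+ 2 = k * e by rewrite sqr_sqrtr // mulr_ge0 // ltW.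
pose P := aff x r; have P1 : \det P = 1 by exact: aff_det.
pose Q := mx2 r^-1 0 0 r.
have Q1 : \det Q = 1 by rewrite det_mx2 mulVf // mulr0 subr0.
have [gP GgP PM] := GM _ P1; have [gQ GgQ QM] := GM _ Q1.
set K1 := invmx Q *m gQ in QM; set K2 := invmx P *m gP in PM.
have gP1 := lat_det GL GgP; have gQ1 := lat_det GL GgQ.
have K11 : \det K1 = 1 by rewrite det_mul1 ?det_inv1.
have K21 : \det K2 = 1 by rewrite det_mul1 ?det_inv1.
have [f [Gf fn fb]] := nP (K1 0 0) (K1 0 1) (invmx K2 0 0) (invmx K2 1 0).
pose W := K1 *m f *m invmx K2.
have W00 : W 0 0 = bil f (K1 0 0) (K1 0 1) (invmx K2 0 0) (invmx K2 1 0).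
  by rewrite /W !mulmx2E /bil; ring.
rewrite -W00 in fb.
have [K1l _] := row_col_lower_bound K11 QM.
have K2M : nrm2 (invmx K2) <= M by rewrite nrm2V.
have [_ K2l] := row_col_lower_bound (det_inv1 K21) K2M.
have WT : nrm2 W <= T.
  apply: (@le_trans _ _ (M * n%:R * M)).
    rewrite (le_trans (nrm2M _ _)) // ler_pM ?nrm2_ge0 //.
    by rewrite (le_trans (nrm2M _ _)) // ler_pM ?nrm2_ge0.
  rewrite /T (_ : _ * M = M ^+ 2 * n%:R); last by ring.
  by rewrite ler_wpM2l ?sqr_ge0 // lerDl.
have W00T : 1 <= T * W 0 0 ^+ 2.
  apply: (@le_trans _ _ (M ^+ 2 * (n%:R * W 0 0 ^+ 2))).
    apply: le_trans (ler_wpM2l (sqr_ge0 M) fb).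
    rewrite expr2 mulrACA -[leLHS]mulr1; exact: ler_pM.
  by rewrite /T -mulrA ler_wpM2l ?sqr_ge0 // ler_wpM2r ?sqr_ge0 // lerDl.
have hE : gQ *m f *m invmx gP = Q *m W *m invmx P.
  rewrite /W /K1 /K2 invmxM2 ?det_inv1 // invmxK !mulmxA mulmxV ?unitmx_det1 //.
  by rewrite mul1mx -!mulmxA mulmxV ?unitmx_det1 // mulmx1.
exists (Q *m W *m invmx P); split.
- rewrite -hE; apply: lat_mul (lat_inv GL GgP) => //; exact: lat_mul.
- have t0 : 0 < k * e by rewrite mulr_gt0.
  have t1 : k * e <= 1.
    rewrite -[leRHS]mulr1 ler_pM ?(ltW k0) ?(ltW e0) //.
    rewrite -[leRHS]kT ler_peMr ?(ltW k0) //.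
    have : 1 <= T ^+ 2 by rewrite expr_ge1 ?(ltW T0).
    by lra.
  have tV : 1 <= (k * e)^-1 by rewrite invf_ge1.
  have nP1 : nrm2 (invmx P) <= (2 + X0 ^+ 2) / (k * e).
    rewrite nrm2V // nrm2_mx2 expr0n addr0 exprMn exprVn r2.
    have : x ^+ 2 <= X0 ^+ 2.
      by rewrite -(real_normK (num_real x)) lerXn2r ?nnegrE // (le_trans _ xX).
    rewrite -(ler_pM2r (lt_le_trans ltr01 tV)) mulrDl; lra.
  have nQ1 : nrm2 Q <= 2 / (k * e).
    by rewrite nrm2_mx2 expr0n !addr0 exprVn r2; lra.
  rewrite (le_trans (nrm2M _ _)) //.
  have -> : 2 * T * (2 + X0 ^+ 2) / k ^+ 2 / e ^+ 2 =
      2 / (k * e) * T * ((2 + X0 ^+ 2) / (k * e)) by field; rewrite !gt_eqF.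
  by rewrite ler_pM ?nrm2_ge0 // (le_trans (nrm2M _ _)) // ler_pM ?nrm2_ge0.
move=> v0 v1 vle.
pose y0 := (v0 - x * v1) / r; pose y1 := r * v1.
have iPE : invmx P = mx2 r^-1 (- (x / r)) 0 r.
  by rewrite invmx2 // !mx2E oppr0.
have hvE i : (Q *m W *m invmx P) i 0 * v0 + (Q *m W *m invmx P) i 1 * v1 =
    Q i 0 * (W 0 0 * y0 + W 0 1 * y1) + Q i 1 * (W 1 0 * y0 + W 1 1 * y1).
  by rewrite iPE !mulmx2E !mx2E /y0 /y1; ring.
rewrite !hvE !mx2E !mul0r addr0 add0r !normrM normfV gtr0_norm //.
have rE : r = e / r * k by rewrite mulrAC [e * k]mulrC -r2 expr2 mulfK.
have er0 : 0 <= e / r by rewrite divr_ge0 // ltW.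
rewrite [X in X * _ <= _]rE -mulrA [leRHS]mulrA ler_wpM2l //.
apply: cone_step T1 WT W00T kT _.
rewrite /y0 /y1 !normrM normfV gtr0_norm // [X in X * _ <= _]rE.
have -> : e / r * k * `|v1| = k * (e * `|v1| / r) by ring.
by rewrite ler_wpM2l ?(ltW k0) // ler_wpM2r // invr_ge0 ltW.
Qed.

(** * Ping-pong *)

(** The boundary action in homogeneous coordinates: (1, 0) stands for infinity and (x, 1) for x, so
    infinity is no special case. *)
Definition act (R : realType) (A : 'M[R]_2) (v : R * R) : R * R :=
  (A 0 0 * v.1 + A 0 1 * v.2, A 1 0 * v.1 + A 1 1 * v.2).

Lemma actM (R : realType) (A B : 'M[R]_2) v : act (A *m B) v = act A (act B v).
Proof. by rewrite /act !mulmx2E /=; congr pair; ring. Qed.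

Lemma act1 (R : realType) (v : R * R) : act 1%:M v = v.
Proof. by case: v => x y; rewrite /act mx2_1 !mx2E /=; congr pair; ring. Qed.

Lemma actK (R : realType) (A : 'M[R]_2) v : \det A = 1 ->
  act A (act (invmx A) v) = v.
Proof. by move=> A1; rewrite -actM mulmxV ?act1 // unitmx_det1. Qed.

Lemma actVK (R : realType) (A : 'M[R]_2) v : \det A = 1 ->
  act (invmx A) (act A v) = v.
Proof. by move=> A1; rewrite -actM mulVmx ?act1 // unitmx_det1. Qed.

Lemma actZ (R : realType) (A : 'M[R]_2) k (v : R * R) :
  act A (k * v.1, k * v.2) = (k * (act A v).1, k * (act A v).2).
Proof. by rewrite /act /=; congr pair; ring. Qed.

Definition cone_infty (R : realType) (e : R) (v : R * R) : Prop :=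
  `|v.2| <= e * `|v.1|.

Definition cone_at (R : realType) (e x : R) (v : R * R) : Prop :=
  `|v.1 - x * v.2| <= e * `|v.2|.

Definition cone_map (R : realType) (e x : R) (h : 'M[R]_2) : Prop :=
  forall v, e * `|v.2| <= `|v.1 - x * v.2| -> cone_infty e (act h v).

(** The slope map s -> (c + d s) / (a + b s) sends [-e, e] to itself, and the intermediate value
    theorem gives a fixed slope. The denominator cannot vanish there: the cone condition would make
    the numerator vanish too, against the determinant. Both ends of the axis come from this lemma,
    with no trace computation. *)
Lemma fixed_direction (R : realType) (a b c d e : R) : 0 < e ->
  a * d - b * c != 0 ->
  (forall s, `|s| <= e -> `|c + d * s| <= e * `|a + b * s|) ->
  exists s, `|s| <= e /\ s * (a + b * s) = c + d * s.
Proof.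
move=> e0 det0 cone.
wlog a0 : a b c d det0 cone / 0 <= a => [hw|].
  have [|/ltW a0] := leP 0 a; first exact: hw.
  have [|s se||s [se sE]] := hw (- a) (- b) (- c) (- d).
  - by rewrite !mulrNN.
  - by rewrite !mulNr -!opprD !normrN; exact: cone.
  - by rewrite oppr_ge0.
  exists s; split=> //; have -> : c + d * s = - (- c + - d * s) by ring.
  by rewrite -sE; ring.
have ba : `|b| * e < a.
  rewrite ltNge; apply/negP => ale.
  have [s [se s0]] : exists s, `|s| <= e /\ a + b * s = 0.
    have [b0|b0] := eqVneq b 0.
      exists 0; rewrite normr0 (ltW e0) b0 mul0r addr0; split=> //.
      by apply/le_anti; rewrite a0 andbT; move: ale; rewrite b0 normr0 mul0r.
    exists (- a / b); split; last by field.
    by rewrite normrM normfV normrN ger0_norm // ler_pdivrMr ?normr_gt0 // mulrC.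
  have := cone s se; rewrite s0 normr0 mulr0 normr_le0 => /eqP c0.
  move/eqP: det0; apply.
  have -> : a = - (b * s) by apply/eqP; rewrite -addr_eq0 s0.
  by have -> : c = - (d * s); [apply/eqP; rewrite -addr_eq0 c0|ring].
have m_gt0 s : `|s| <= e -> 0 < a + b * s.
  move=> se; have : `|b * s| <= `|b| * e by rewrite normrM ler_wpM2l.
  by rewrite ler_norml => /andP[+ _]; lra.
pose f s := s * (a + b * s) - (c + d * s).
have ee : `|e| <= e by rewrite gtr0_norm.
have eN : `|- e| <= e by rewrite normrN gtr0_norm.
have fe : 0 <= f e.
  have := cone _ ee; rewrite (gtr0_norm (m_gt0 _ ee)) ler_norml => /andP[_].
  by rewrite /f subr_ge0.
have fN : f (- e) <= 0.
  have := cone _ eN; rewrite (gtr0_norm (m_gt0 _ eN)) ler_norml => /andP[+ _].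
  by rewrite /f subr_le0 mulNr.
have [|||s] := @IVT R f (- e) e 0.
- by lra.
- apply: continuous_subspaceT => s; rewrite /f.
  apply: cvgB; last first.
    by apply: cvgD; [exact: cvg_cst|apply: cvgM => //; exact: cvg_cst].
  apply: cvgM => //; apply: cvgD; first exact: cvg_cst.
  by apply: cvgM => //; exact: cvg_cst.
- by rewrite ge_min le_max fN fe orbT.
rewrite in_itv /= -ler_norml => se /eqP; rewrite subr_eq0 => /eqP sE.
by exists s.
Qed.

Lemma one_sub_gt0 (R : realType) (a b c e : R) :
  `|a| <= c -> `|b| <= e -> e * c < 1 -> 0 < 1 - a * b.
Proof.
move=> ac be ec; rewrite subr_gt0; apply: le_lt_trans ec.
by rewrite (le_trans (ler_norm _)) // normrM mulrC ler_pM.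
Qed.

Section PingPong.
Context {R : realType} {G : set 'M[R]_2} {e X0 B : R} {h : R -> 'M[R]_2}.
Hypothesis GL : sl2_lattice G.
Hypotheses (e0 : 0 < e) (eX : e * (X0 + e) < 1).
Hypothesis hP : forall x, `|x| <= X0 ->
  [/\ G (h x), nrm2 (h x) <= B & cone_map e x (h x)].

Let word (xs : seq R) := foldr (fun x A => h x *m A) 1%:M xs.
Let bounded (xs : seq R) := forall x, x \in xs -> `|x| <= X0.

(** By [eX] the cone at infinity meets no e-cone at an admissible [x] in its interior, so any letter
    may follow any other. *)
Lemma cone_infty_step x v : `|x| <= X0 -> cone_infty e v ->
  e * `|v.2| <= `|v.1 - x * v.2|.
Proof.
rewrite /cone_infty => xX ve; have v1 : `|v.1| - X0 * `|v.2| <= `|v.1 - x * v.2|.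
  have := ler_normD (v.1 - x * v.2) (x * v.2); rewrite subrK normrM => le.
  by rewrite lerBlDr (le_trans le) // lerD2l ler_wpM2r.
apply: le_trans v1; rewrite -(ler_pM2l e0).
have := ler_wpM2r (normr_ge0 v.2) (ltW eX); rewrite mul1r.
by move: `|v.1| `|v.2| ve => p q; lra.
Qed.

Lemma cone_at_not_infty x v : `|x| <= X0 -> v != 0 -> cone_at e x v ->
  ~ cone_infty e v.
Proof.
case: v => p q xX v0; rewrite /cone_at /cone_infty /= => pq qp.
have pX : `|p| <= (X0 + e) * `|q|.
  have := ler_normD (p - x * q) (x * q); rewrite subrK normrM => le.
  have := ler_wpM2r (normr_ge0 q) xX; lra.
have q0 : `|q| = 0.
  apply/le_anti; rewrite normr_ge0 andbT leNgt; apply/negP => q0.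
  have : e * (X0 + e) * `|q| < `|q| by rewrite gtr_pMl.
  by have := ler_wpM2l (ltW e0) pX; rewrite mulrA; lra.
move: pX; rewrite q0 mulr0 normr_le0 => /eqP p0.
by move: v0; rewrite p0 (normr0_eq0 q0) eqxx.
Qed.

Lemma word_in xs : bounded xs -> G (word xs) /\ nrm2 (word xs) <= 2 * B ^+ size xs.
Proof.
elim: xs => [_|x xs IH bx] /=.
  by rewrite expr0 mulr1 mx2_1 nrm2_mx2; split; [rewrite -mx2_1; exact: lat_1|lra].
have [|IHG IHn] := IH; first by move=> y yx; apply: bx; rewrite inE yx orbT.
have [|Gx nx _] := @hP x; first by apply: bx; rewrite mem_head.
split; first exact: lat_mul.
rewrite (le_trans (nrm2M _ _)) // exprS mulrCA ler_pM ?nrm2_ge0 //.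
Qed.

Lemma word_cat xs ys : word (xs ++ ys) = word xs *m word ys.
Proof. by elim: xs => [|x xs IH] /=; rewrite ?mul1mx // IH mulmxA. Qed.

Lemma word_cone xs v : bounded xs -> cone_infty e v -> cone_infty e (act (word xs) v).
Proof.
elim: xs => [_|x xs IH bx ve] /=; first by rewrite act1.
have xX : `|x| <= X0 by apply: bx; rewrite mem_head.
rewrite actM; have [_ _] := hP xX; apply; apply: cone_infty_step => //.
by apply: IH => // y yx; apply: bx; rewrite inE yx orbT.
Qed.

(** In [word] the last letter acts before all others. Were the preimage outside the e-cone at [x],
    this letter would send it into the cone at infinity and the remaining ones would keep it
    there. *)
Lemma word_rcons_inv xs x v : bounded (rcons xs x) -> ~ cone_infty e v ->
  cone_at e x (act (invmx (word (rcons xs x))) v).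
Proof.
move=> bx nv; have xX : `|x| <= X0 by apply: bx; rewrite mem_rcons mem_head.
have bxs : bounded xs by move=> y yx; apply: bx; rewrite mem_rcons inE yx orbT.
have [Gw _] := word_in bx; have w1 := lat_det GL Gw.
rewrite /cone_at leNgt; apply/negP => /ltW; set w := act _ v => wP.
apply: nv; have -> : v = act (word (rcons xs x)) w by rewrite actK.
rewrite -cats1 word_cat actM; apply: word_cone => //=; rewrite mulmx1.
by have [_ _] := hP xX; apply.
Qed.

(** (1, b) and (a, 1) are the ends of the axis of [A]. The matrix [S] conjugates [A] to a cyclic
    rearrangement of the word, whose axis therefore ends near infinity and near the letter [x]. *)
Lemma ping_pong xs : xs != [::] -> bounded xs ->
  exists (A : 'M[R]_2) (a b l m : R),
  [/\ G A /\ nrm2 A <= 2 * B ^+ size xs, `|b| <= e /\ `|a| <= X0 + e,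
      act A (1, b) = (l, l * b) /\ act A (a, 1) = (m * a, m),
      l * m = 1 /\ l ^+ 2 != 1 &
      forall x, x \in xs -> exists S, [/\ G S, cone_infty e (act S (1, b)) &
        cone_at e x (act S (a, 1))]].
Proof.
case/lastP: xs => // xs y _ bx; have [Gw nw] := word_in bx.
set A := word (rcons xs y) in Gw nw *; have A1 := lat_det GL Gw.
have yX : `|y| <= X0 by apply: bx; rewrite mem_rcons mem_head.
have detN0 : A 0 0 * A 1 1 - A 0 1 * A 1 0 != 0 by rewrite -det2E A1 oner_eq0.
have [|b [be bE]] := fixed_direction e0 detN0.
  move=> s se; have := @word_cone _ (1, s) bx.
  by rewrite /cone_infty /act /= normr1 !mulr1; exact.
(* The other end is fixed by the inverse of [A], which preserves the e-cone at the last letter [y];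
   [fixed_direction] is applied to this inverse written in the basis (y, 1), (1, 0). *)
have [s [se sE]] : exists s, `|s| <= e /\
    exists m, act (invmx A) (y + s, 1) = (m * (y + s), m).
  set I := invmx A; have I1 : \det I = 1 by exact: det_inv1.
  have [|t te|s [se sE]] := @fixed_direction R (I 1 0 * y + I 1 1) (I 1 0)
    (I 0 0 * y + I 0 1 - y * (I 1 0 * y + I 1 1)) (I 0 0 - y * I 1 0) e e0.
  - by rewrite [X in X != 0](_ : _ = 1) ?oner_eq0 // -[RHS]I1 det2E; ring.
  - have nv : ~ cone_infty e (y + t, 1).
      apply: (@cone_at_not_infty y) => //.
        by apply/eqP => -[_ /eqP]; rewrite oner_eq0.
      by rewrite /cone_at /= mulr1 addrAC subrr add0r normr1 mulr1.
    have := word_rcons_inv bx nv; rewrite -/A -/I /cone_at /act /= !mulr1.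
    have -> : I 1 0 * y + I 1 1 + I 1 0 * t = I 1 0 * (y + t) + I 1 1 by ring.
    have -> : I 0 0 * y + I 0 1 - y * (I 1 0 * y + I 1 1) +
        (I 0 0 - y * I 1 0) * t =
        I 0 0 * (y + t) + I 0 1 - y * (I 1 0 * (y + t) + I 1 1) by ring.
    exact.
  exists s; split=> //; exists (I 1 0 * (y + s) + I 1 1).
  rewrite /act /= !mulr1; congr pair; apply/eqP; rewrite -subr_eq0; apply/eqP.
  rewrite -[RHS](subrr (s * (I 1 0 * y + I 1 1 + I 1 0 * s))) {1}sE; ring.
move: sE => [m mE]; set a := y + s in mE *.
have ae : `|a| <= X0 + e by rewrite (le_trans (ler_normD _ _)) // lerD.
have ab0 : 0 < 1 - a * b by exact: (one_sub_gt0 ae be eX).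
have ab : 1 - a * b != 0 by rewrite gt_eqF.
pose l := A 0 0 + A 0 1 * b.
have lE : act A (1, b) = (l, l * b).
  by rewrite /act /= !mulr1 -/l -bE mulrC.
have m0 : m != 0.
  apply/eqP => m0; have := actK (a, 1) A1; rewrite mE m0 /act /= mul0r.
  by move=> [_ /eqP]; rewrite !mulr0 addr0 eq_sym oner_eq0.
have {}mE : act A (a, 1) = (m^-1 * a, m^-1).
  have -> : (a, 1) = (m^-1 * (m * a, m).1, m^-1 * (m * a, m).2).
    by rewrite /= mulKf // mulVf.
  by rewrite actZ -mE actK //= mulr1.
pose mu := m^-1; rewrite -/mu in mE.
have lbE : A 1 0 + A 1 1 * b = l * b by rewrite -bE mulrC.
have [maE muE] : A 0 0 * a + A 0 1 = mu * a /\ A 1 0 * a + A 1 1 = mu.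
  by move: mE; rewrite /act /= !mulr1 => -[].
have lmu : l * mu = 1.
  apply: (mulIf ab); rewrite mul1r.
  have -> : l * mu * (1 - a * b) = l * mu - (mu * a) * (l * b) by ring.
  rewrite -lbE -maE -muE /l -[RHS]mul1r -[X in _ = X * _]A1 det2E; ring.
have va : ~ cone_infty e (a, 1).
  apply: (@cone_at_not_infty y) => //.
    by apply/eqP => -[_ /eqP]; rewrite oner_eq0.
  by rewrite /cone_at /= mulr1 /a addrAC subrr add0r normr1 mulr1.
exists A, a, b, l, mu; split=> //.
(* Equal eigenvalues would make [A] the scalar [l], which fixes the direction of (y + e, 1); yet [A]
   sends that direction into the cone at infinity, against [eX]. *)
- split=> //; apply/negP => /eqP l2.
  have mul : mu = l by rewrite -[LHS]mul1r -l2 expr2 -mulrA lmu mulr1.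
  rewrite mul in maE muE.
  have A00 : A 0 0 = l.
    apply/eqP; rewrite -subr_eq0 -(mulIr_eq0 _ (mulIf ab)); apply/eqP.
    transitivity (A 0 0 + A 0 1 * b - l - b * (A 0 0 * a + A 0 1 - l * a)).
      by ring.
    by rewrite -/l maE !subrr mulr0 subr0.
  have A11 : A 1 1 = l.
    apply/eqP; rewrite -subr_eq0 -(mulIr_eq0 _ (mulIf ab)); apply/eqP.
    transitivity (A 1 0 * a + A 1 1 - l - a * (A 1 0 + A 1 1 * b - l * b)).
      by ring.
    by rewrite lbE muE !subrr mulr0 subr0.
  have A01 : A 0 1 = 0 by apply: (addrI (A 0 0 * a)); rewrite maE A00 addr0.
  have A10 : A 1 0 = 0 by apply: (addIr (A 1 1 * b)); rewrite lbE A11 add0r.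
  have := @word_cone xs (act (h y) (y + e, 1)).
  rewrite -actM; have -> : word xs *m h y = A.
    by rewrite /A -cats1 word_cat /= mulmx1.
  have bxs : bounded xs by move=> z zx; apply: bx; rewrite mem_rcons inE zx orbT.
  have hy : cone_infty e (act (h y) (y + e, 1)).
    have [_ _] := hP yX; apply; rewrite /= mulr1 addrAC subrr add0r normr1 mulr1.
    exact: ler_norm.
  move=> /(_ bxs hy); rewrite /cone_infty /act /= A00 A01 A10 A11.
  rewrite mul0r mulr1 add0r mul0r addr0 normrM.
  have l0 : 0 < `|l|.
    by rewrite normr_gt0; apply: contra_eq_neq l2 => ->; rewrite expr0n eq_sym oner_eq0.
  rewrite mulrCA -[X in X <= _]mulr1 ler_pM2l //; apply/negP; rewrite -ltNge.
  apply: le_lt_trans eX; rewrite ler_pM2l // (le_trans (ler_normD _ _)) // lerD //.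
  by rewrite gtr0_norm.
- move=> x xin.
  (* The word is cut after the letter [x]: [S] is the suffix, and on the eigenvector (a, 1) it
     agrees, up to the eigenvalue, with the inverse of the prefix, whose last letter is [x]. *)
  have [p1 [p2 E]] : exists p1 p2, rcons xs y = rcons p1 x ++ p2.
    by case/path.splitP: xin => p1 p2; exists p1, p2.
  have bp1 : bounded (rcons p1 x).
    by move=> z zp; apply: bx; rewrite E mem_cat zp.
  have bp2 : bounded p2 by move=> z zp; apply: bx; rewrite E mem_cat zp orbT.
  have [GP _] := word_in bp1; have P1 := lat_det GL GP.
  exists (word p2); split; first by have [] := word_in bp2.
    by apply: word_cone => //; rewrite /cone_infty /= normr1 mulr1.
  have AE : A = word (rcons p1 x) *m word p2 by rewrite /A E word_cat.
  have -> : act (word p2) (a, 1) = act (invmx (word (rcons p1 x))) (act A (a, 1)).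
    by rewrite AE actM actVK.
  have -> : act A (a, 1) = (mu * (a, 1 : R).1, mu * (a, 1 : R).2).
    by rewrite mE /= mulr1.
  rewrite actZ /cone_at /= mulrCA -mulrBr !normrM mulrCA ler_wpM2l //.
  by have := word_rcons_inv bp1 va; rewrite /cone_at.
Qed.
End PingPong.

(** * Closed geodesics *)

(** Elements with [nrm2] at most 3 have their entries in a compact box, where discreteness leaves
    locally at most one of them; so the values of [nrm2] cannot accumulate at 2. *)
Lemma lattice_gap (R : realType) (G : set 'M[R]_2) : sl2_lattice G ->
  (forall A, G A -> nrm2 A = 2 -> A = 1%:M \/ A = - 1%:M) ->
  exists2 rho : R, 0 < rho &
    forall A, G A -> [\/ A = 1%:M, A = - 1%:M | 2 + rho <= nrm2 A].
Proof.
move=> GL free; have [d d0 Gd] := lat_isolated1 GL.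
pose mat (x : (R * R) * (R * R)) := mx2 x.1.1 x.1.2 x.2.1 x.2.2.
have I2 : compact `[-2 : R, 2]%classic by exact: segment_compact.
have /compact_near_coveringP/(_ nat \oo (fun n x => G (mat x) -> nrm2 (mat x) <= 3 ->
  [\/ mat x = 1%:M, mat x = - 1%:M | 1 <= n%:R * (nrm2 (mat x) - 2)]) _) :=
  compact_setX (compact_setX I2 I2) (compact_setX I2 I2).
case=> [x _|n _ /(_ n (leqnn n)) nP].
  (* Two elements of one ball differ by at most 2 r in each of the four entries, so their quotient
     is within 3 * 16 * (d / 50) < d of 1. *)
  pose r : R := Num.sqrt (d / 50); have r0 : 0 < r by rewrite sqrtr_gt0 divr_gt0.
  have same (y z : (R * R) * (R * R)) :
      ball x r y -> ball x r z -> G (mat y) -> G (mat z) ->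
      nrm2 (mat y) <= 3 -> mat y = mat z.
    move=> xy xz Gy Gz y3; have uy := unitmx_det1 (lat_det GL Gy).
    suff : invmx (mat y) *m mat z = 1%:M.
      by move=> E; rewrite -[LHS]mulmx1 -E mulmxA mulmxV // mul1mx.
    apply: Gd; first by apply: (lat_mul GL) Gz; exact: lat_inv.
    rewrite -(mulVmx uy) -mulmxBr; apply: le_lt_trans (nrm2M _ _) _.
    rewrite nrm2V ?(lat_det GL) //.
    apply: (@le_lt_trans _ _ (3 * nrm2 (mat z - mat y))).
      by rewrite ler_wpM2r ?nrm2_ge0.
    have sq (a b c : R) : ball a r b -> ball a r c -> (c - b) ^+ 2 <= 4 * (d / 50).
      rewrite /ball /= => ab ac.
      have cb : `|c - b| <= r + r.
        have -> : c - b = (a - b) - (a - c) by ring.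
        by rewrite (le_trans (ler_normB _ _)) // lerD // ltW.
      rewrite -(real_normK (num_real _)) (_ : 4 * _ = (r + r) ^+ 2).
        by rewrite lerXn2r ?nnegrE // addr_ge0 // ltW.
      by rewrite -[in LHS](@sqr_sqrtr _ (d / 50)) ?divr_ge0 ?(ltW d0) // -/r; ring.
    rewrite /nrm2 !mxE /=.
    case: xy => -[/= xy1 xy2] [/= xy3 xy4]; case: xz => -[/= xz1 xz2] [/= xz3 xz4].
    have := sq _ _ _ xy1 xz1; have := sq _ _ _ xy2 xz2.
    have := sq _ _ _ xy3 xz3; have := sq _ _ _ xy4 xz4; lra.
  have [[y [xy Gy y3]]|nex] :=
    pselect (exists y, [/\ ball x r y, G (mat y) & nrm2 (mat y) <= 3]); last first.
    exists (ball x r, setT); first by split; [exact: nbhsx_ballx|exact: filterT].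
    by move=> [y m] /= [xy _] Gy y3; case: nex; exists y.
  have [y2|y2] := eqVneq (nrm2 (mat y)) 2.
    exists (ball x r, setT); first by split; [exact: nbhsx_ballx|exact: filterT].
    move=> [z m] /= [xz _] Gz z3; rewrite -(same _ _ xy xz Gy Gz y3).
    by case: (free _ Gy y2) => ->; [constructor 1|constructor 2].
  have g0 : 0 < nrm2 (mat y) - 2.
    by rewrite subr_gt0 lt_neqAle eq_sym y2 nrm2_ge2 // (lat_det GL).
  exists (ball x r, [set m | (nrm2 (mat y) - 2)^-1 <= m%:R]).
    by split; [exact: nbhsx_ballx|exact: nbhs_infty_ger].
  move=> [z m] /= [xz mle] Gz z3; rewrite -(same _ _ xy xz Gy Gz y3).
  by constructor 3; rewrite -ler_pdivrMr // mul1r.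
exists (n.+1%:R^-1); first by rewrite invr_gt0.
move=> A GA; have [A3|/ltW A3] := leP (nrm2 A) 3; last first.
  constructor 3; apply: le_trans A3; have : n.+1%:R^-1 <= 1 :> R.
    by rewrite invf_le1 // ler1n.
  by move: (_^-1) => z; lra.
pose x := ((A 0 0, A 0 1), (A 1 0, A 1 1)).
have xA : mat x = A by rewrite [RHS]mx2_eta.
have entry i j : A i j \in `[-2, 2].
  rewrite in_itv /= -ler_norml -(ler_pXn2r (ltn0Sn 1)) ?nnegrE // real_normK ?num_real //.
  by apply: le_trans (sqr_le_nrm2 _ _ _) (le_trans A3 _); lra.
have := nP x; rewrite xA => /(_ _ GA A3)[|||le].
- by split; split; exact: entry.
- by constructor 1.
- by constructor 2.
- constructor 3; rewrite -lerBrDl -[leLHS]mul1r ler_pdivrMr // mulrC.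
  rewrite (le_trans le) // ler_wpM2r ?subr_ge0 ?nrm2_ge2 ?(lat_det GL) //.
  by rewrite ler_nat.
Qed.

(** By [nrm2_det1] a conjugate with [nrm2] equal to 2 is a rotation, so [A] fixes [B i] and freeness
    leaves only 1 and -1. Thus [rho] bounds from below how far the other elements move [B i]. *)
Lemma fuchsian_gap (R : realType) (G : set 'M[R]_2) (B : 'M[R]_2) :
  free_fuchsian G -> sl2_lattice G -> \det B = 1 ->
  exists2 rho : R, 0 < rho & forall A, G A ->
    [\/ A = 1%:M, A = - 1%:M | 2 + rho <= nrm2 (invmx B *m A *m B)].
Proof.
move=> GF GL B1; have uB := unitmx_det1 B1.
have conj1 A : invmx B *m A *m B = 1%:M -> A = 1%:M.
  move=> E; rewrite -[LHS]mulmx1 -(mulmxV uB) -[A]mul1mx -(mulmxV uB).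
  by rewrite mulmxA -(mulmxA B) -(mulmxA B) E mulmx1.
have conjN A : invmx B *m A *m B = - 1%:M -> A = - 1%:M.
  move=> E; apply: oppr_inj; rewrite opprK; apply: conj1.
  by rewrite mulmxN mulNmx E opprK.
have [|rho rho0 gap] := lattice_gap (lattice_conj B1 GL).
  move=> _ [A GA <-] E; have A1 := fuchsian_det GF GA.
  suff [->|->] : A = 1%:M \/ A = - 1%:M.
    by left; rewrite mulmx1 mulVmx.
    by right; rewrite mulmxN mulNmx mulmx1 mulVmx.
  apply: (fuchsian_free GF GA (upt_im_gt0 B1)).
  set K := _ *m B in E; have K1 : \det K = 1 by rewrite !det_mul1 ?det_inv1.
  have -> : mobius A (upt B) = mobius B (upt K).
    by rewrite !mobius_upt // /K !mulmxA mulmxV // mul1mx.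
  congr mobius; have [_ ->] := uptE K1.
  move: E; rewrite nrm2_det1 // -addrA -[RHS]addr0 => /addrI/eqP.
  rewrite paddr_eq0 ?sqr_ge0 // !expf_eq0 /= subr_eq0 addr_eq0 => /andP[/eqP k0 /eqP k1].
  move: K1; rewrite det2E k0 k1 => K1.
  congr Complex; last first.
    by rewrite [_ + _](_ : _ = 1) ?divr1 // -[RHS]K1; ring.
  by rewrite [_ + _](_ : _ = 0) ?mul0r //; ring.
exists rho => // A GA; have [|||] := gap (invmx B *m A *m B).
- by exists A.
- by move=> /conj1; constructor 1.
- by move=> /conjN; constructor 2.
- by constructor 3.
Qed.

(** Geodesic flow on frames, at unit speed thanks to the halves in the exponents. The columns of [C]
    are the forward and backward endpoints. *)
Definition geo (R : realType) (C : 'M[R]_2) (t : R) : 'M[R]_2 :=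
  C *m mx2 (expR (t / 2)) 0 0 (expR (- (t / 2))).

Lemma geo_det (R : realType) (C : 'M[R]_2) t : \det C = 1 -> \det (geo C t) = 1.
Proof.
move=> C1; apply: det_mul1 => //.
by rewrite det_mx2 mulr0 subr0 -expRD subrr expR0.
Qed.

Lemma geoD (R : realType) (C : 'M[R]_2) s t : geo C (s + t) = geo (geo C s) t.
Proof.
rewrite /geo -mulmxA mulmx2; congr (_ *m mx2 _ _ _ _); last first.
- by rewrite mul0r add0r -expRD; congr expR; field.
- by ring.
- by ring.
- by rewrite mulr0 addr0 -expRD; congr expR; field.
Qed.

Lemma le_nrm2_diag (R : realType) (K : 'M[R]_2) (s u w : R) :
  `|s| < w -> `|u| < w ->
  expR (- (2 * w)) * nrm2 K <= nrm2 (geo 1%:M (- s) *m geo K u).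
Proof.
rewrite !ltr_norml => /andP[s1 s2] /andP[u1 u2].
rewrite /geo mul1mx (mx2_eta K) !mulmx2 !nrm2_mx2 !mulrDr.
have key (a x y : R) : - (2 * w) <= x + x + (y + y) ->
    expR (- (2 * w)) * a ^+ 2 <= (expR x * (a * expR y)) ^+ 2.
  move=> xy; rewrite [leRHS](_ : _ = expR (x + x + (y + y)) * a ^+ 2).
    by rewrite ler_wpM2r ?sqr_ge0 // ler_expR.
  by rewrite !expRD; ring.
rewrite !(mulr0, mul0r, addr0, add0r).
by rewrite !lerD // key //; lra.
Qed.

Lemma nrm2_geo (R : realType) (s u : R) :
  nrm2 (geo 1%:M (- s) *m geo 1%:M u) = expR (u - s) + expR (- (u - s)).
Proof.
rewrite /geo !mul1mx mulmx2 nrm2_mx2 !(mulr0, mul0r, addr0, add0r) expr0n /= !addr0.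
rewrite -!expRD !expr2 -!expRD.
by congr (expR _ + expR _); field.
Qed.

Lemma geo_inv (R : realType) (C K : 'M[R]_2) (s : R) : \det C = 1 ->
  invmx (geo C s) *m K = geo 1%:M (- s) *m (invmx C *m K).
Proof.
move=> C1; rewrite /geo invmxM2 ?mul1mx // ?det_mx2 -?expRD ?subrr ?expR0;
  last by rewrite mulr0 subr0.
rewrite -mulmxA [invmx (mx2 _ _ _ _)]invmx2
  ?det_mx2 -?expRD ?subrr ?expR0 ?mulr0 ?subr0 //.
by rewrite !mx2E oppr0 mulNr opprK.
Qed.

Section Geodesic.
Context {R : realType} {X : metricType R} {G : set 'M[R]_2} {p : R[i] -> X}.
Hypotheses (GF : free_fuchsian G) (GL : sl2_lattice G).
Hypothesis Gp : quotient_projection G p.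

Lemma geo_local_isometry (C : 'M[R]_2) (t : R) : \det C = 1 ->
  exists2 d : R, 0 < d & forall s u, `|s - t| < d -> `|u - t| < d ->
    mdist (p (upt (geo C s))) (p (upt (geo C u))) = `|s - u|.
Proof.
move=> C1; set B := geo C t; have B1 : \det B = 1 by exact: geo_det.
have [rho rho0 gap] := fuchsian_gap GF GL B1.
(* Chosen so that exp(-2 w) (2 + rho) >= 2 exp(2 w): for |s|, |u| < w, elements other than 1 and -1
   then give distances at least |s - u|. *)
pose w := ln (1 + rho / 2) / 4.
have w0 : 0 < w by rewrite divr_gt0 // ln_gt0 // ltrDl divr_gt0.
have gE v : geo C v = geo B (v - t) by rewrite /B -geoD subrKC.
exists w => // s u; rewrite (gE s) (gE u).
rewrite (_ : s - u = (s - t) - (u - t)); last by ring.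
move: (s - t) (u - t) => {}s {}u sw uw.
rewrite (mdist_proj_upt GF Gp) ?geo_det //.
set S := [set _ | _ in _].
have val g : invmx (geo B s) *m (g *m geo B u) =
    geo 1%:M (- s) *m geo (invmx B *m g *m B) u.
  by rewrite geo_inv // /geo !mulmxA.
have cosh : arcosh (nrm2 (geo 1%:M (- s) *m geo 1%:M u) / 2) = `|s - u|.
  by rewrite nrm2_geo arcosh_cosh distrC.
have in1 : S `|s - u|.
  exists 1%:M; first exact: fuchsian_1 GF.
  by rewrite val mulmx1 mulVmx ?cosh // unitmx_det1.
have lb : lbound S `|s - u|.
  move=> _ [g Gg <-]; rewrite val -cosh; apply: le_arcosh.
    rewrite nrm2_half_ge1 // det_mul1 // geo_det ?det1 //.
  rewrite ler_pM2r ?invr_gt0 //; case: (gap _ Gg) => [->|->|gle].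
  - by rewrite mulmx1 mulVmx // unitmx_det1.
  - rewrite mulmxN mulNmx mulmx1 mulVmx ?unitmx_det1 //.
    by rewrite /geo mulNmx mulmxN; set Y := _ *m _; rewrite /nrm2 !mxE !sqrrN.
  apply: le_trans _ (le_nrm2_diag _ sw uw).
  apply: le_trans (ler_wpM2l (expR_ge0 _) gle).
  have e2 x : `|x| <= 2 * w -> expR x <= expR (2 * w).
    by rewrite ler_expR => /(le_trans (ler_norm _)).
  have suw : `|u - s| <= 2 * w.
    by rewrite (le_trans (ler_normB _ _)) // mulr_natl mulr2n lerD // ltW.
  rewrite nrm2_geo; apply: (@le_trans _ _ (expR (2 * w) + expR (2 * w))).
    by rewrite lerD // e2 // normrN.
  rewrite -(ler_pM2l (expR_gt0 (2 * w))) mulrA -expRD subrr expR0 mul1r.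
  rewrite mulrDr -expRD (_ : 2 * w + 2 * w = ln (1 + rho / 2)); last first.
    by rewrite /w; field.
  rewrite lnK ?posrE; last by rewrite addr_gt0 // divr_gt0.
  lra.
apply/le_anti; rewrite (ge_inf _ in1) /=; last by exists `|s - u|.
by apply: lb_le_inf => //; exists `|s - u|.
Qed.

Lemma geo_periodic (C A : 'M[R]_2) (l m : R) : \det C = 1 -> G A ->
  A *m C = C *m mx2 l 0 0 m -> l * m = 1 ->
  forall t, p (upt (geo C (t + ln (l ^+ 2)))) = p (upt (geo C t)).
Proof.
move=> C1 GA AC lm t.
have l0 : l != 0 by apply: contra_eq_neq lm => ->; rewrite mul0r eq_sym oner_eq0.
have e1 : expR (ln (l ^+ 2) / 2) = `|l|.
  rewrite -(real_normK (num_real l)) lnXn ?normr_gt0 // -[ln _ *+ _]mulr_natr mulfK //.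
  by rewrite lnK // posrE normr_gt0.
have mE : m = l^-1 by rewrite -[LHS]mul1r -(mulVf l0) -mulrA lm mulr1.
have e2 : expR (- (ln (l ^+ 2) / 2)) = `|m|.
  by rewrite expRN e1 mE normfV.
have AE : A *m geo C t = C *m mx2 l 0 0 m *m mx2 (expR (t / 2)) 0 0 (expR (- (t / 2))).
  by rewrite /geo mulmxA AC.
rewrite -(proj_upt GF Gp GA (geo_det t C1)) AE addrC geoD /geo e1 e2.
have [l_gt0|] := ltP 0 l; first by rewrite !gtr0_norm // mE invr_gt0.
move=> l_le0; rewrite !ler0_norm ?mE ?invr_le0 //.
by rewrite -[X in mx2 _ X _ _]oppr0 -[X in mx2 _ _ X _]oppr0
  -mx2N mulmxN mulNmx /upt mobiusN.
Qed.

End Geodesic.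

(** * Density of the axis and its length *)

Lemma fundamental_box (R : realType) (X : metricType R) (G : set 'M[R]_2)
    (p : R[i] -> X) (M : R) : free_fuchsian G -> quotient_projection G p ->
  cocompact G M -> forall z, exists x r,
  [/\ 0 < r, p (upt (aff x r)) = z, `|x| <= M & r ^+ 2 <= M /\ 1 <= M * r ^+ 2].
Proof.
move=> GF Gp GM z; have [A A1 <-] := proj_surj_upt Gp z.
have [g Gg gM] := GM _ A1; have g1 := fuchsian_det GF Gg.
pose B := invmx g *m A; have B1 : \det B = 1 by rewrite det_mul1 ?det_inv1.
have BM : nrm2 B <= M.
  have -> : B = invmx (invmx A *m g) by rewrite invmxM2 ?det_inv1 // invmxK.
  by rewrite nrm2V // det_mul1 ?det_inv1.
have M0 : 0 <= M by exact: le_trans (nrm2_ge0 _) BM.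
rewrite -(proj_upt GF Gp (fuchsian_inv GF Gg) A1) -/B.
have [q0 zE] := uptE B1; rewrite zE; set q := (_ + _) in q0 zE *.
set n := _ * _ + _ in zE *; pose k := B 0 0 ^+ 2 + B 0 1 ^+ 2.
(* Lagrange's identity for the rows of [B]. As k and q are at most [M], it bounds the height 1/q
   from above and the abscissa n/q. *)
have nq : n ^+ 2 + 1 = k * q.
  rewrite -[X in _ + X](expr1n _ 2) -{1}B1 det2E /n /k /q; ring.
have qM : q <= M.
  apply: le_trans BM; rewrite /nrm2 -addrA lerDr addr_ge0 ?sqr_ge0 //.
have kM : k <= M.
  by apply: le_trans BM; rewrite /nrm2 -!addrA addrA lerDl addr_ge0 ?sqr_ge0.
have q1 : q^-1 <= M.
  rewrite -[leLHS]mul1r ler_pdivrMr // (le_trans _ (ler_wpM2r (ltW q0) kM)) //.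
  by rewrite -nq lerDr sqr_ge0.
have r0 : 0 < Num.sqrt q^-1 by rewrite sqrtr_gt0 invr_gt0.
have r2 : Num.sqrt q^-1 ^+ 2 = q^-1 by rewrite sqr_sqrtr // invr_ge0 ltW.
exists (n / q), (Num.sqrt q^-1); rewrite r2; split=> //.
- by rewrite upt_aff ?gt_eqF // r2 mul1r.
- rewrite -(ler_pXn2r (ltn0Sn 1)) ?nnegrE // real_normK ?num_real // exprMn exprVn.
  rewrite (_ : M ^+ 2 = M * M) //; apply: (@le_trans _ _ (k / q)).
    rewrite expr2 invfM mulrA ler_wpM2r ?invr_ge0 ?(ltW q0) // ler_pdivrMr //.
    by rewrite -nq lerDl.
  by rewrite ler_pM // ?invr_ge0 ?(ltW q0) // /k addr_ge0 ?sqr_ge0.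
- by split=> //; rewrite ler_pdivlMr // mul1r.
Qed.

(** [mx2 P (a * Q) (b * P) Q] frames the geodesic with endpoints 1/b and a, and [E] moves along it.
    The condition on [E] selects the point matching height r^2, at which P, Q and E drop out of the
    result; for a = x and b = 0 the right side is 2, that is distance 0. *)
Lemma nrm2_axis (R : realType) (x r a b P Q E : R) : r != 0 -> E != 0 ->
  P * Q * (1 - a * b) = 1 -> E ^+ 2 * P = r ^+ 2 * Q ->
  nrm2 (invmx (aff x r) *m (mx2 P (a * Q) (b * P) Q *m mx2 E 0 0 E^-1))
    * (1 - a * b) =
  (1 - x * b) ^+ 2 + (a - x) ^+ 2 * (r ^+ 2)^-1 ^+ 2 + (r ^+ 2) ^+ 2 * b ^+ 2 + 1.
Proof.
move=> r0 E0 PQ EP; set w := 1 - a * b in PQ *.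
have P0 : P != 0.
  by apply: contra_eq_neq PQ => ->; rewrite !mul0r eq_sym oner_eq0.
have Q0 : Q != 0.
  by apply: contra_eq_neq PQ => ->; rewrite mulr0 mul0r eq_sym oner_eq0.
have wE : w = (P * Q)^-1.
  by rewrite -[LHS]mul1r -(mulVf (mulf_neq0 P0 Q0)) -mulrA PQ mulr1.
have p2 : (P * E) ^+ 2 * w = r ^+ 2.
  rewrite wE exprMn (_ : P ^+ 2 * E ^+ 2 = P * (E ^+ 2 * P)); last by ring.
  by rewrite EP; field; rewrite P0 Q0.
have q2 : (Q * E^-1) ^+ 2 * w = (r ^+ 2)^-1.
  apply: (mulfI (expf_neq0 2 r0)); rewrite mulfV ?expf_neq0 //.
  rewrite (_ : r ^+ 2 * _ = r ^+ 2 * Q * Q * w / E ^+ 2); last by field.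
  by rewrite -EP -[RHS]PQ; field.
rewrite invmx2 ?aff_det // !mx2E !mulmx2 nrm2_mx2.
rewrite !(mulr0, mul0r, addr0, add0r, oppr0) -[b * P * E]mulrA -[a * Q * _]mulrA.
move: (P * E) (Q * E^-1) p2 q2 => p1 q1 p2 q2.
rewrite (_ : _ * w = (p1 ^+ 2 * w) * ((1 - x * b) ^+ 2 * (r ^+ 2)^-1 + r ^+ 2 * b ^+ 2)
   + (q1 ^+ 2 * w) * ((a - x) ^+ 2 * (r ^+ 2)^-1 + r ^+ 2)); last first.
  by field.
by rewrite p2 q2; field.
Qed.

(** The first-order terms cancel: (1 - x b)^2 + 1 - 2 (1 - a b) = 2 b (a - x) + (x b)^2, and all
    terms left are quadratic in the errors. Their total, at most (6 M^2 + 4) e^2, is rounded up to a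
    square. *)
Lemma axis_close (R : realType) (M e x y a b : R) : 0 <= M -> 0 <= e ->
  `|x| <= M -> 0 < y -> y <= M -> 1 <= M * y -> `|b| <= e -> `|a - x| <= 2 * e ->
  (1 - x * b) ^+ 2 + (a - x) ^+ 2 * y^-1 ^+ 2 + y ^+ 2 * b ^+ 2 + 1 <=
  2 * (1 - a * b) + (e * (3 * M + 2)) ^+ 2.
Proof.
move=> M0 e0 xM y0 yM My be ax.
have sq (u v : R) : `|u| <= v -> u ^+ 2 <= v ^+ 2.
  by move=> uv; rewrite -(real_normK (num_real u)) lerXn2r ?nnegrE // (le_trans _ uv).
have h1 : (x * b) ^+ 2 <= (M * e) ^+ 2 by apply: sq; rewrite normrM ler_pM.
have h2 : b * (a - x) <= e * (2 * e).
  by rewrite (le_trans (ler_norm _)) // normrM ler_pM.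
have yV : y^-1 <= M by rewrite -[leLHS]mul1r ler_pdivrMr.
have yV0 : 0 <= y^-1 by rewrite invr_ge0 ltW.
have h3 : ((a - x) * y^-1) ^+ 2 <= (2 * e * M) ^+ 2.
  by apply: sq; rewrite normrM ler_pM // ger0_norm.
have h4 : (y * b) ^+ 2 <= (M * e) ^+ 2.
  by apply: sq; rewrite normrM ler_pM // ger0_norm // ltW.
have h5 : 0 <= M * e ^+ 2 by rewrite mulr_ge0 ?sqr_ge0.
have h6 : 0 <= M ^+ 2 * e ^+ 2 by rewrite mulr_ge0 ?sqr_ge0.
rewrite -[(a - x) ^+ 2 * _]exprMn -[y ^+ 2 * _]exprMn -subr_ge0.
rewrite (_ : _ - _ = ((M * e) ^+ 2 - (x * b) ^+ 2) + 2 * (e * (2 * e) - b * (a - x))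
  + ((2 * e * M) ^+ 2 - ((a - x) * y^-1) ^+ 2) + ((M * e) ^+ 2 - (y * b) ^+ 2)
  + 3 * (M ^+ 2 * e ^+ 2) + 12 * (M * e ^+ 2)); last by ring.
have k (u v : R) : u <= v -> 0 <= v - u by rewrite subr_ge0.
exact: (addr_ge0 (addr_ge0 (addr_ge0 (addr_ge0 (addr_ge0 (k _ _ h1)
  (mulr_ge0 (ler0n _ 2) (k _ _ h2))) (k _ _ h3)) (k _ _ h4))
  (mulr_ge0 (ler0n _ 3) h6)) (mulr_ge0 (ler0n _ 12) h5)).
Qed.

Lemma grid (R : realType) (M e : R) : 0 <= M -> 0 < e -> exists xs : seq R,
  [/\ xs != [::], forall x, x \in xs -> `|x| <= M,
      forall x, `|x| <= M -> exists2 x', x' \in xs & `|x - x'| <= e &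
      (size xs)%:R <= 2 * M / e + 1].
Proof.
move=> M0 e0; pose N := Num.Def.truncn (2 * M / e).
have Me0 : 0 <= 2 * M / e by rewrite divr_ge0 ?mulr_ge0 // ltW.
have NM : N%:R <= 2 * M / e by rewrite truncn_le.
exists [seq - M + k%:R * e | k <- iota 0 N.+1]; split.
- by [].
- move=> x /mapP[k]; rewrite mem_iota add0n ltnS => /andP[_ kN] ->.
  have : k%:R * e <= 2 * M.
    by rewrite -ler_pdivlMr // (le_trans _ NM) // ler_nat.
  have : 0 <= k%:R * e by rewrite mulr_ge0 // ltW.
  by rewrite ler_norml; lra.
- move=> x; rewrite ler_norml => /andP[x1 x2].
  have xM : 0 <= (x + M) / e by rewrite divr_ge0 ?(ltW e0) //; lra.
  pose k := Num.Def.truncn ((x + M) / e).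
  have /andP[k1 k2] := truncn_itv xM; rewrite -/k in k1 k2.
  exists (- M + k%:R * e).
    apply/mapP; exists k => //; rewrite mem_iota add0n ltnS /=.
    rewrite /k /N le_truncn // ler_wpM2r ?invr_ge0 ?(ltW e0) //; lra.
  move: k1 k2; rewrite ler_pdivlMr // ltr_pdivrMr // -natr1 mulrDl mul1r => k1 k2.
  by rewrite ler_norml; lra.
- by rewrite size_map size_iota -natr1 lerD2r.
Qed.

Section DenseGeodesic.
Context {R : realType} {X : metricType R} {G : set 'M[R]_2} {p : R[i] -> X}.
Context {M C : R}.
Hypotheses (GF : free_fuchsian G) (GL : sl2_lattice G).
Hypothesis Gp : quotient_projection G p.
Hypothesis GM : cocompact G M.
Hypothesis C0 : 0 < C.
Hypothesis cone : forall x e, `|x| <= M -> 0 < e -> e <= 1 -> exists h : 'M[R]_2,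
  [/\ G h, nrm2 h <= C / e ^+ 2 &
    forall v0 v1, e * `|v1| <= `|v0 - x * v1| ->
      `|h 1 0 * v0 + h 1 1 * v1| <= e * `|h 0 0 * v0 + h 0 1 * v1|].

Lemma closed_geodesic_geo (A D : 'M[R]_2) (l m : R) : \det D = 1 -> G A ->
  A *m D = D *m mx2 l 0 0 m -> l * m = 1 -> l ^+ 2 != 1 ->
  closed_geodesic (fun t => p (upt (geo D t))) `|ln (l ^+ 2)|.
Proof.
move=> D1 GA AD lm l2; have per := geo_periodic GF Gp D1 GA AD lm.
have l0 : 0 < l ^+ 2.
  rewrite lt_neqAle sqr_ge0 andbT eq_sym expf_eq0 /=.
  by apply: contra_eq_neq lm => ->; rewrite mul0r eq_sym oner_eq0.
split.
- by rewrite normr_gt0 ln_eq0.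
- move=> t; have [_|_] := ger0P (ln (l ^+ 2)); first exact: per.
  by rewrite -[in LHS]per subrK.
- by move=> t; exact: (geo_local_isometry GF GL Gp).
Qed.

Lemma eigenvalue_bound_l (A : 'M[R]_2) (l b : R) :
  act A (1, b) = (l, l * b) -> l ^+ 2 <= nrm2 A.
Proof.
rewrite /act /= !mulr1 => -[l1 l2].
have := cauchy_schwarz2 (A 0 0) (A 0 1) 1 b.
have := cauchy_schwarz2 (A 1 0) (A 1 1) 1 b.
rewrite !mulr1 l1 l2 expr1n => h2 h1.
have b0 : 0 < 1 + b ^+ 2 by rewrite ltr_pwDl // sqr_ge0.
rewrite -(ler_pM2r b0) (_ : l ^+ 2 * _ = l ^+ 2 + (l * b) ^+ 2); last by ring.
by apply: le_trans (lerD h1 h2) _; rewrite -mulrDl /nrm2 !addrA.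
Qed.

Lemma eigenvalue_bound_r (A : 'M[R]_2) (m a : R) :
  act A (a, 1) = (m * a, m) -> m ^+ 2 <= nrm2 A.
Proof.
rewrite /act /= !mulr1 => -[l1 l2].
have := cauchy_schwarz2 (A 0 0) (A 0 1) a 1.
have := cauchy_schwarz2 (A 1 0) (A 1 1) a 1.
rewrite !mulr1 l1 l2 expr1n => h2 h1.
have b0 : 0 < a ^+ 2 + 1 by rewrite ltr_wpDl // sqr_ge0.
rewrite -(ler_pM2r b0) (_ : m ^+ 2 * _ = (m * a) ^+ 2 + m ^+ 2); last by ring.
by apply: le_trans (lerD h1 h2) _; rewrite -mulrDl /nrm2 !addrA.
Qed.

Lemma abs_ln_le (l m N : R) : l * m = 1 -> l ^+ 2 <= N -> m ^+ 2 <= N ->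
  `|ln (l ^+ 2)| <= ln N.
Proof.
move=> lm lN mN.
have l0 : 0 < l ^+ 2.
  rewrite lt_neqAle sqr_ge0 andbT eq_sym expf_eq0 /=.
  by apply: contra_eq_neq lm => ->; rewrite mul0r eq_sym oner_eq0.
have m2 : m ^+ 2 = (l ^+ 2)^-1.
  apply: (mulfI (lt0r_neq0 l0)); rewrite mulfV ?gt_eqF // -exprMn lm expr1n //.
have N0 : 0 < N by exact: lt_le_trans lN.
rewrite ler_norml lerNl -lnV ?posrE // -m2 !ler_ln ?posrE //.
  by rewrite mN lN.
by rewrite m2 invr_gt0.
Qed.

Lemma dense_geodesic (e : R) : 0 < e -> e * (M + e) <= 1 / 2 ->
  e * (3 * M + 2) <= 1 -> exists (c : R -> X) (L : R),
  [/\ closed_geodesic c L,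
      forall z, exists t, mdist z (c t) <= 3 * (e * (3 * M + 2)) &
      L <= ln 2 + (2 * M / e + 1) * `|ln (C / e ^+ 2)|].
Proof.
move=> e0 eM eK; have M2 := lattice_cocompact_gt0 GL GM.
have M0 : 0 <= M by exact: le_trans M2.
have e1 : e <= 1.
  apply: le_trans eK; rewrite ler_peMr ?(ltW e0) //.
  by rewrite -[leLHS]add0r lerD ?mulr_ge0 // ler1n.
have eX : e * (M + e) < 1.
  by apply: le_lt_trans eM _; rewrite div1r invf_lt1 // ltr1n.
have /choice[h hP] : forall x, exists h : 'M[R]_2, `|x| <= M ->
    [/\ G h, nrm2 h <= C / e ^+ 2 & cone_map e x h].
  move=> x; have [xM|_] := leP `|x| M; last by exists 1%:M.
  have [h [Gh hC hx]] := cone xM e0 e1; exists h => _; split=> // v; exact: hx.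
have [xs [xs0 xsM xs_net xs_size]] := grid M0 e0.
have [A [a [b [l [m [[GA Anrm] [be ae] [lE mE] [lm l2] xsP]]]]]] :=
  ping_pong GL e0 eX hP xs0 xsM.
have ab0 : 0 < 1 - a * b by exact: one_sub_gt0 ae be eX.
pose w := Num.sqrt (1 - a * b); have w0 : w != 0 by rewrite gt_eqF // sqrtr_gt0.
have w2 : w ^+ 2 = 1 - a * b by rewrite sqr_sqrtr // ltW.
pose D := mx2 (1 / w) (a / w) (b / w) (1 / w).
have D1 : \det D = 1.
  rewrite det_mx2 (_ : _ - _ = (1 - a * b) / w ^+ 2); last by field.
  by rewrite w2 mulfV // gt_eqF.
have DE S : S *m D = mx2 ((act S (1, b)).1 / w) ((act S (a, 1)).1 / w)
    ((act S (1, b)).2 / w) ((act S (a, 1)).2 / w).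
  by rewrite (mx2_eta S) mulmx2 /act !mx2E /=; congr mx2; ring.
have AD : A *m D = D *m mx2 l 0 0 m.
  by rewrite DE lE mE mulmx2 /=; congr mx2; ring.
exists (fun t => p (upt (geo D t))), `|ln (l ^+ 2)|; split.
- exact: closed_geodesic_geo GA AD lm l2.
- move=> z; have [x [r [r0 <- xM [rM Mr]]]] := fundamental_box GF Gp GM z.
  have rN0 : r != 0 by rewrite gt_eqF.
  have [x' x'xs xx'] := xs_net _ xM.
  have [S [GS Sinf Sat]] := xsP _ x'xs.
  have SD1 : \det (S *m D) = 1 by rewrite det_mul1 // (lat_det GL).
  move: SD1 (DE S) Sinf Sat; rewrite /cone_infty /cone_at.
  move: (act S (1, b)) (act S (a, 1)) => [v0 v1] [u0 u1] /= SD1 SDE v_inf u_at.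
  have detE : v0 * u1 - u0 * v1 = w ^+ 2.
    by move: SD1; rewrite SDE det_mx2 => E; rewrite -[RHS]mulr1 -E; field.
  have w2N0 : w ^+ 2 != 0 by rewrite expf_neq0.
  have v00 : v0 != 0.
    apply: contraNneq w2N0 => v00; move: v_inf detE.
    rewrite v00 normr0 mulr0 normr_le0 => /eqP ->.
    by rewrite mul0r mulr0 subr0 => <-.
  have u10 : u1 != 0.
    apply: contraNneq w2N0 => u10; move: u_at detE.
    rewrite u10 mulr0 subr0 normr0 mulr0 normr_le0 => /eqP ->.
    by rewrite mul0r mulr0 subr0 => <-.
  (* [al] is one endpoint of the axis translated by [S], and [bt] the inverse of the other; [P] and
     [Q] give [S *m D] the shape required by [nrm2_axis]. *)
  pose al := u0 / u1; pose bt := v1 / v0; pose P := v0 / w; pose Q := u1 / w.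
  have bte : `|bt| <= e by rewrite normrM normfV ler_pdivrMr ?normr_gt0.
  have al' : `|al - x'| <= e.
    rewrite (_ : al - x' = (u0 - x' * u1) / u1); last by rewrite /al; field.
    by rewrite normrM normfV ler_pdivrMr ?normr_gt0.
  have alx : `|al - x| <= 2 * e.
    rewrite (_ : al - x = (al - x') - (x - x')); last by ring.
    by rewrite (le_trans (ler_normB _ _)) // mulr_natl mulr2n lerD.
  have alM : `|al| <= M + e.
    rewrite -[al](subrK x') addrC (le_trans (ler_normD _ _)) // lerD //.
    exact: xsM.
  have ab2 : `|al * bt| <= 1 / 2.
    by rewrite (le_trans _ eM) // normrM mulrC ler_pM.
  have ab1 : 1 / 2 <= 1 - al * bt.
    rewrite lerBrDl -lerBrDr (_ : 1 - 1 / 2 = 1 / 2); last by field.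
    exact: le_trans (ler_norm _) ab2.
  have PQ : P * Q * (1 - al * bt) = 1.
    rewrite (_ : _ * _ = (v0 * u1 - u0 * v1) / w ^+ 2).
      by rewrite detE mulfV.
    by rewrite /P /Q /al /bt; field; rewrite v00 u10 w0.
  have om0 : 0 < 1 - al * bt by rewrite (lt_le_trans _ ab1) // divr_gt0.
  have PQ0 : 0 < P * Q.
    have : 0 < P * Q * (1 - al * bt) by rewrite PQ.
    by rewrite pmulr_lgt0.
  have P0 : P != 0 by rewrite mulf_neq0 // invr_eq0.
  have QP0 : 0 < r ^+ 2 * (Q / P).
    rewrite mulr_gt0 ?exprn_gt0 // (_ : Q / P = P * Q / P ^+ 2); last by field.
    by rewrite divr_gt0 // exprn_even_gt0.
  (* The time on the axis that solves the balance condition of [nrm2_axis]. *)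
  pose t := ln (r ^+ 2 * (Q / P)); pose E := expR (t / 2).
  have E2 : E ^+ 2 * P = r ^+ 2 * Q.
    rewrite expr2 -expRD -splitr lnK ?posrE //; field; exact: P0.
  exists t; apply: le_trans (mdist_proj_upt_le GF Gp _ _ GS) _.
  - exact: aff_det.
  - exact: geo_det.
  set N := invmx (aff x r) *m _; have N1 : \det N = 1.
    by rewrite det_mul1 ?det_inv1 ?aff_det // det_mul1 ?geo_det // (lat_det GL).
  pose k := e * (3 * M + 2); rewrite -/k in eK *.
  have k0 : 0 <= k by rewrite /k mulr_ge0 ?(ltW e0) // addr_ge0 // mulr_ge0.
  have NE : nrm2 N * (1 - al * bt) <= 2 * (1 - al * bt) + k ^+ 2.
    have -> : N = invmx (aff x r) *m
        (mx2 P (al * Q) (bt * P) Q *m mx2 E 0 0 E^-1).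
      rewrite /N /geo mulmxA SDE expRN -/E; congr (_ *m (mx2 _ _ _ _ *m _)).
        by rewrite /al /Q; field; rewrite u10 w0.
      by rewrite /bt /P; field; rewrite v00 w0.
    rewrite (@nrm2_axis R x r al bt P Q E rN0 (lt0r_neq0 (expR_gt0 _)) PQ E2).
    by apply: axis_close; rewrite ?(ltW e0) // exprn_gt0.
  have N2 : nrm2 N / 2 - 1 <= k ^+ 2.
    have k2 := ler_wpM2r (sqr_ge0 k) ab1.
    rewrite lerBlDr ler_pdivrMr // -(ler_pM2r om0) (le_trans NE) //.
    move: (1 - al * bt) (k ^+ 2) k2 => om kk k2; lra.
  rewrite (_ : nrm2 N / 2 = 1 + (nrm2 N / 2 - 1)); last by ring.
  apply: arcosh1D_le => //; first by rewrite subr_ge0 nrm2_half_ge1.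
  by rewrite k0.
- have B0 : 0 < C / e ^+ 2 by rewrite divr_gt0 // exprn_gt0.
  apply: le_trans (abs_ln_le lm (eigenvalue_bound_l lE) (eigenvalue_bound_r mE)) _.
  have A0 : 0 < nrm2 A by apply: lt_le_trans (nrm2_ge2 (lat_det GL GA)).
  apply: (@le_trans _ _ (ln (2 * (C / e ^+ 2) ^+ size xs))).
    by rewrite ler_ln ?posrE // mulr_gt0 // exprn_gt0.
  (* C / e^2 may be less than 1, so the absolute value is taken when the number of letters is
     replaced by its upper bound. *)
  rewrite lnM ?posrE ?exprn_gt0 // lerD2l lnXn // -[ln _ *+ _]mulr_natl.
  apply: le_trans (ler_wpM2r (normr_ge0 _) xs_size).
  by rewrite ler_wpM2l // ler_norm.
Qed.
End DenseGeodesic.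

(** The quotient e / (3 (3 M + 2)) is the grid step used for density e. Since 1/e >= 2, constants
    are absorbed by multiples of ln(1/e) >= ln 2, hence the division by [ln 2] in [c], and the
    additive 1 by 1/e. *)
Lemma log_length_bound (R : realType) (M C : R) : 0 <= M -> 0 < C ->
  exists2 A : R, 0 < A & forall e, 0 < e -> e <= 1 / 2 ->
    ln 2 + (2 * M / (e / (3 * (3 * M + 2))) + 1) *
      `|ln (C / (e / (3 * (3 * M + 2))) ^+ 2)| <= A * (1 / e) * ln (1 / e).
Proof.
move=> M0 C0; pose k := 3 * (3 * M + 2).
have k0 : 0 < k by rewrite /k; lra.
have l2 : 0 < ln 2 :> R by rewrite ln_gt0 // ltr1n.
pose c := (`|ln C| + 2 * `|ln k|) / ln 2.
have c0 : 0 <= c by rewrite divr_ge0 ?(ltW l2) // addr_ge0 // mulr_ge0.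
have M2k : 0 <= 2 * M * k by rewrite (mulr_ge0 (mulr_ge0 (ler0n _ 2) M0) (ltW k0)).
have A0 : 0 < 1 + (2 * M * k + 1) * (c + 2).
  by rewrite ltr_pwDl // mulr_ge0 // addr_ge0.
exists (1 + (2 * M * k + 1) * (c + 2)) => // e e0 e2; rewrite -/k div1r.
set i := e^-1; set lam := ln i.
have i0 : 0 < i by rewrite invr_gt0.
have i2 : 2 <= i by rewrite -[leLHS]invrK lef_pV2 ?posrE // -div1r.
have lam2 : ln 2 <= lam by rewrite ler_ln ?posrE.
have lam0 : 0 < lam by exact: lt_le_trans l2 lam2.
have eE : e / k = (i * k)^-1 by rewrite /i; field; rewrite !gt_eqF.
rewrite eE invrK (_ : C / _ ^+ 2 = C * (i * k) ^+ 2); last first.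
  by rewrite exprVn invrK.
have aux (c' x y z : R) : x + 2 * y <= c' * z -> x + 2 * (z + y) <= (c' + 2) * z.
  by lra.
have lnB : `|ln (C * (i * k) ^+ 2)| <= (c + 2) * lam.
  have ik0 : 0 < i * k by exact: mulr_gt0.
  rewrite lnM ?posrE ?exprn_gt0 // lnXn // lnM ?posrE // -/lam.
  rewrite -[(_ + _) *+ 2]mulr_natl (le_trans (ler_normD _ _)) //.
  rewrite normrM ger0_norm // (le_trans (lerD (lexx _) (ler_wpM2l _ (ler_normD _ _)))) //.
  rewrite [`|lam|]ger0_norm ?(ltW lam0) //.
  have : (`|ln C| + 2 * `|ln k|) <= c * lam.
    have -> : `|ln C| + 2 * `|ln k| = c * ln 2 by rewrite /c mulfVK // gt_eqF.
    by rewrite ler_wpM2l.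
  exact: aux.
have i1 : 1 <= i by lra.
apply: (@le_trans _ _ (i * lam + (2 * M * k + 1) * i * ((c + 2) * lam))); last first.
  by rewrite le_eqVlt; apply/orP; left; apply/eqP; ring.
apply: lerD; first by rewrite (le_trans lam2) // ler_peMl // ltW.
rewrite (mulrCA _ i) [i * (_ * _)]mulrC.
apply: (ler_pM _ _ _ lnB) => //.
  by rewrite addr_ge0 // mulr_ge0 // ltW.
by rewrite [leRHS]mulrDl mul1r; apply: lerD.
Qed.

Theorem theorem1p1 (R : realType) (g : nat) (hg : (2 <= g)%N)
    (X : metricType R) (hX : closed_hyperbolic_surface X)
    (hgenus : has_genus X g) :
  exists C : R, 0 < C /\
    forall e : R, 0 < e -> e <= 1 / 2 ->
      exists (c : R -> X) (L : R),
        [/\ closed_geodesic c L,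
            eps_dense e (range c)
          & L <= C * (1 / e) * ln (1 / e)].
Proof.
have [Xc [G [p [GF Gp]]]] := hX; have GL := fuchsian_lattice Xc GF Gp.
have [M GM] := lat_cocompact GL; have M2 := lattice_cocompact_gt0 GL GM.
have M0 : 0 <= M by lra.
have [C [C0 cone]] := lattice_cone_map M GL.
have [A A0 bound] := log_length_bound M0 C0; exists A; split=> // e e0 e2.
pose k := 3 * M + 2; have k0 : 0 < k by rewrite /k; lra.
(* With this grid step the distance bound 3 d (3 M + 2) is exactly [e]. *)
pose d := e / (3 * k).
have dk : d * k = e / 3 by rewrite /d; field; rewrite gt_eqF.
have d0 : 0 < d by rewrite divr_gt0 // mulr_gt0.
have dM : d * (M + d) <= 1 / 2.
  have d1 : d <= 1 by rewrite ler_pdivrMr ?mulr_gt0 // /k; lra.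
  apply: (@le_trans _ _ (d * k)); last by rewrite dk; lra.
  by rewrite ler_wpM2l ?(ltW d0) // /k; lra.
have dk1 : d * k <= 1 by rewrite dk; lra.
have [c [L [geod dense Lle]]] := dense_geodesic GF GL Gp GM C0 cone d0 dM dk1.
exists c, L; split=> //; last exact: le_trans Lle (bound _ e0 e2).
move=> x; have [t xt] := dense x; apply: (@le_trans _ _ (mdist x (c t))).
  apply: ge_inf; last by exists (c t) => //; exists t.
  by exists 0 => _ [y _ <-]; exact: mdist_ge0.
by rewrite (le_trans xt) // -/k dk; lra.
Qed.
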